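(* Let $\Phi: G\times M\to M$ be a pre-Hamiltonian action of a Poisson Lie group $(G,\pi_G)$ on a Poisson manifold $(M,\pi)$ with infinitesimal momentum map $\tilde\varphi:\mathfrak g\to\Omega^1(M)$. (i) The infinitesimal generator $\varphi^T:\mathfrak g\to\Gamma(T(TM))$ of the tangent lift of $\Phi$ (the action of $G$ on $TM$ by the differentials of the diffeomorphisms $\Phi_g$) is given by $$\varphi^T(\xi)=X_{i_T\tilde\varphi_\xi}+\pi^\sharp_{TM}\circ i_T d\tilde\varphi_\xi\qquad(\xi\in\mathfrak g),$$ where $X_{i_T\tilde\varphi_\xi}$ is the Hamiltonian vector field on $(TM,\pi_{TM})$ of the function $i_T\tilde\varphi_\xi$. (ii) If $d\tilde\varphi_\xi=0$ for each $\xi\in\mathfrak g$, then the lifted (infinitesimal) action on $(TM,\pi_{TM})$ is Hamiltonian, with fiberwise-linear momentum map $c:TM\to\mathfrak g^*$ defined by $c_\xi=i_T\tilde\varphi_\xi$, where $c_\xi(v)=\langle c(v),\xi\rangle$.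
   Context: Conventions. For a Poisson manifold $(M,\pi)$: $\{f,g\}=\pi(df,dg)$, $\pi^\sharp(\alpha)=\pi(\alpha,\cdot)$, $X_f=\pi^\sharp(df)$, and $[\alpha,\beta]_\pi=\mathcal L_{\pi^\sharp\alpha}\beta-\mathcal L_{\pi^\sharp\beta}\alpha-d(\pi(\alpha,\beta))$ is the Lie bracket on $\Omega^1(M)$. A Poisson Lie group $(G,\pi_G)$ is a Lie group with a multiplicative Poisson structure; its Lie algebra $\mathfrak g$ carries the $1$-cocycle $\delta=d_e\pi_G:\mathfrak g\to\mathfrak g\wedge\mathfrak g$, where $\delta(\xi)=(\mathcal L_X\pi_G)(e)$ for any vector field $X$ on $G$ with $X(e)=\xi$. The infinitesimal generator of an action $\Phi$ on $M$ is $\varphi:\mathfrak g\to\Gamma(TM)$, $\varphi(\xi)(m)=\frac{d}{dt}|_{t=0}\Phi(\exp(t\xi),m)$ (and similarly for the action on $TM$); the bracket of $\mathfrak g$ is normalized so that $\varphi$ is a Lie algebra homomorphism (i.e. it is the bracket of right-invariant vector fields). An infinitesimal momentum map for an action of $(G,\pi_G)$ on $(M,\pi)$ is a linear map $\tilde\varphi:\mathfrak g\to\Omega^1(M)$, $\xi\mapsto\tilde\varphi_\xi$, such that (a) $\tilde\varphi_{[\xi,\eta]}=[\tilde\varphi_\xi,\tilde\varphi_\eta]_\pi$; (b) $d\tilde\varphi_\xi=(\tilde\varphi\wedge\tilde\varphi)(\delta(\xi))$; (c) $\varphi(\xi)=\pi^\sharp(\tilde\varphi_\xi)$. An action is pre-Hamiltonian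 if it is generated by an infinitesimal momentum map. With $\tau_M:TM\to M$ the projection, $i_T:\Omega^k(M)\to\Omega^{k-1}(TM)$ is defined by $(i_T\omega)_v(w_1,\dots,w_{k-1})=\omega_{\tau_M(v)}(v,T\tau_M(w_1),\dots,T\tau_M(w_{k-1}))$ for $v\in TM$, $w_j\in T_v(TM)$, and $i_T$ is zero on functions; for a $1$-form $\theta$, $i_T\theta$ is the function $v\mapsto\langle\theta(\tau_M(v)),v\rangle$ on $TM$. $\pi_{TM}$ denotes the complete (tangent) lift of $\pi$: the Poisson structure on $TM$ determined by $\{i_T\alpha,i_T\beta\}=i_T[\alpha,\beta]_\pi$, $\{i_T\alpha,f\circ\tau_M\}=(\pi^\sharp(\alpha)f)\circ\tau_M$, $\{f\circ\tau_M,g\circ\tau_M\}=0$ for $\alpha,\beta\in\Omega^1(M)$, $f,g\in C^\infty(M)$. An infinitesimal action $\psi$ of $\mathfrak g$ on a Poisson manifold $P$ is Hamiltonian with momentum map $J:P\to\mathfrak g^*$ if $\psi(\xi)=X_{J_\xi}$ for all $\xi$, where $J_\xi=\langle J,\xi\rangle$, and $J$ is a Poisson map for the Lie–Poisson structure on $\mathfrak g^*$, i.e. $\{J_\xi,J_\eta\}=J_{[\xi,\eta]}$. *)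

(* Defs.v *)
From HB Require Import structures.
From mathcomp Require Import all_boot all_order all_algebra.
From mathcomp Require Import all_classical all_reals all_analysis.
Import Order.TTheory GRing.Theory Num.Theory numFieldNormedType.Exports.

Set Implicit Arguments.
Unset Strict Implicit.
Unset Printing Implicit Defensive.

Local Open Scope classical_set_scope.
Local Open Scope ring_scope.

(* A manifold is presented here by an
   atlas on a bare type (the topology is the one induced by the charts) in
   which every point m has a preferred chart [chart_at m] around it, and T_m M
   is the model space 'rV_n, a vector being identified with its coordinates in
   the preferred chart at m.  Tangent objects at m are thus:
     - vectors           u : 'rV_n;
     - covectors         a : 'cV_n,  with <a, u> = (u *m a) 0 0;
     - 2-forms           w : 'M_n,   with w(u, v) = (u *m w *m v^T) 0 0;
     - bivectors         P : 'M_n,   with P(a, b) = (a^T *m P *m b) 0 0.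
   Their coordinates in another chart are obtained from the Jacobian matrix of
   the change of charts; matrices act on row vectors from the right, so that
   'D_u f x = u *m jacobian f x.  In particular, the local expression of a
   field around m in the chart [chart_at m] takes at m the value of the field. *)

Section Smoothness.
Context {R : realType} {V W : normedModType R}.

(* Meaningful for U open *)
Fixpoint Ck (k : nat) (U : set V) (f : V -> W) : Prop :=
  if k is k'.+1 then
    (forall x, U x -> differentiable f x) /\
    (forall v, Ck k' U (fun x => 'D_v f x))
  else forall x, U x -> {for x, continuous f}.

Definition smooth_on (U : set V) (f : V -> W) : Prop := forall k, Ck k U f.

End Smoothness.

Record chart (R : realType) (n : nat) (M : Type) := Chart {
  cdom : set M;
  cmap : M -> 'rV[R]_n;
  cinv : 'rV[R]_n -> M }.

Record atlas (R : realType) (n : nat) (M : Type) := Atlas {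
  charts : set (chart R n M);
  chart_at : M -> chart R n M }.

Definition cimg {R : realType} {n : nat} {M : Type} (c : chart R n M) :
  set 'rV[R]_n := cmap c @` cdom c.

Section Manifolds.
Context {R : realType}.

Definition mopen {n : nat} {M : Type} (A : atlas R n M) (U : set M) : Prop :=
  forall c, charts A c -> open (cmap c @` (cdom c `&` U)).

Record is_manifold {n : nat} {M : Type} (A : atlas R n M) : Prop := {
  chart_at_atlas : forall m, charts A (chart_at A m);
  chart_at_dom : forall m, cdom (chart_at A m) m;
  cmapK : forall c, charts A c -> {in cdom c, cancel (cmap c) (cinv c)};
  open_cimg : forall c, charts A c -> open (cimg c);
  open_overlap : forall c c', charts A c -> charts A c' ->
    open (cmap c @` (cdom c `&` cdom c'));
  smooth_transition : forall c c', charts A c -> charts A c' ->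
    smooth_on (cmap c @` (cdom c `&` cdom c')) (cmap c' \o cinv c);
  manifold_hausdorff : forall m m', m <> m' ->
    exists U U', [/\ mopen A U, mopen A U', U m, U' m' & U `&` U' = set0];
  manifold_second_countable : exists B : nat -> set M,
    (forall i, mopen A (B i)) /\
    (forall U m, mopen A U -> U m -> exists i, B i m /\ B i `<=` U) }.

(* Changes of coordinates at m between the preferred chart at m and c. *)
Definition to_chart {n : nat} {M : Type} (A : atlas R n M) (c : chart R n M)
    (m : M) : 'M[R]_n :=
  jacobian (cmap c \o cinv (chart_at A m)) (cmap (chart_at A m) m).

Definition of_chart {n : nat} {M : Type} (A : atlas R n M) (c : chart R n M)
    (m : M) : 'M[R]_n :=
  jacobian (cmap (chart_at A m) \o cinv c) (cmap c m).

Definition smooth_map {n k : nat} {M N : Type} (A : atlas R n M)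
    (B : atlas R k N) (F : M -> N) : Prop :=
  forall c c', charts A c -> charts B c' ->
    let U := cmap c @` (cdom c `&` F @^-1` cdom c') in
    open U /\ smooth_on U (cmap c' \o F \o cinv c).

Definition smooth_curve {n : nat} {M : Type} (A : atlas R n M)
    (g : R -> M) : Prop :=
  forall c, charts A c ->
    open (g @^-1` cdom c) /\ smooth_on (g @^-1` cdom c) (cmap c \o g).

Definition smooth_fun {n : nat} {M : Type} (A : atlas R n M)
    {W : normedModType R} (f : M -> W) : Prop :=
  forall c, charts A c -> smooth_on (cimg c) (f \o cinv c).

(* T_m F : T_m M -> T_(F m) N *)
Definition tangent_map {n k : nat} {M N : Type} (A : atlas R n M)
    (B : atlas R k N) (F : M -> N) (m : M) : 'M[R]_(n, k) :=
  jacobian (cmap (chart_at B (F m)) \o F \o cinv (chart_at A m))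
    (cmap (chart_at A m) m).

Definition prod_chart {n k : nat} {M N : Type} (c : chart R n M)
    (c' : chart R k N) : chart R (n + k) (M * N) :=
  {| cdom := cdom c `*` cdom c';
     cmap := fun p => row_mx (cmap c p.1) (cmap c' p.2);
     cinv := fun x => (cinv c (lsubmx x), cinv c' (rsubmx x)) |}.

Definition prod_atlas {n k : nat} {M N : Type} (A : atlas R n M)
    (B : atlas R k N) : atlas R (n + k) (M * N) :=
  {| charts := [set prod_chart c c' | c in charts A & c' in charts B];
     chart_at := fun p => prod_chart (chart_at A p.1) (chart_at B p.2) |}.

(* The tangent bundle TM, as the type of pairs (m, u) with u in T_m M *)
Definition tangent_chart {n : nat} {M : Type} (A : atlas R n M)
    (c : chart R n M) : chart R (n + n) (M * 'rV[R]_n) :=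
  {| cdom := [set v | cdom c v.1];
     cmap := fun v => row_mx (cmap c v.1) (v.2 *m to_chart A c v.1);
     cinv := fun x => let m := cinv c (lsubmx x) in
                      (m, rsubmx x *m of_chart A c m) |}.

Definition tangent_atlas {n : nat} {M : Type} (A : atlas R n M) :
    atlas R (n + n) (M * 'rV[R]_n) :=
  {| charts := [set tangent_chart A c | c in charts A];
     chart_at := fun v => tangent_chart A (chart_at A v.1) |}.

End Manifolds.

Section Tensors.
Context {R : realType} {n : nat} {M : Type}.
Variable A : atlas R n M.
Implicit Types (c : chart R n M) (m : M) (f : M -> R).
Implicit Types (X Y : M -> 'rV[R]_n) (al be : M -> 'cV[R]_n).
Implicit Types (pi : M -> 'M[R]_n).

Definition vloc c X : 'rV[R]_n -> 'rV[R]_n :=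
  fun x => X (cinv c x) *m to_chart A c (cinv c x).

Definition floc c al : 'rV[R]_n -> 'cV[R]_n :=
  fun x => of_chart A c (cinv c x) *m al (cinv c x).

Definition bloc c pi : 'rV[R]_n -> 'M[R]_n :=
  fun x => let J := to_chart A c (cinv c x) in J^T *m pi (cinv c x) *m J.

Definition smooth_form al : Prop :=
  forall c, charts A c -> smooth_on (cimg c) (floc c al).

Definition smooth_bivector pi : Prop :=
  forall c, charts A c -> smooth_on (cimg c) (bloc c pi).

(* (df)_i = d_i f *)
Definition dfun f : M -> 'cV[R]_n := fun m =>
  let c := chart_at A m in
  \col_i 'D_(delta_mx 0 i) (f \o cinv c) (cmap c m).

(* (d al)_ij = d_i al_j - d_j al_i *)
Definition dform al : M -> 'M[R]_n := fun m =>
  let c := chart_at A m in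
  let J := jacobian (fun x => (floc c al x)^T) (cmap c m) in J - J^T.

(* [X, Y]^j = X^i d_i Y^j - Y^i d_i X^j *)
Definition vbracket X Y : M -> 'rV[R]_n := fun m =>
  let c := chart_at A m in
  X m *m jacobian (vloc c Y) (cmap c m) - Y m *m jacobian (vloc c X) (cmap c m).

(* (L_X be)_j = X^i d_i be_j + be_i d_j X^i *)
Definition lie_form X be : M -> 'cV[R]_n := fun m =>
  let c := chart_at A m in
  'D_(X m) (floc c be) (cmap c m) + jacobian (vloc c X) (cmap c m) *m be m.

(* (L_X pi)^ij = X^k d_k pi^ij - pi^kj d_k X^i - pi^ik d_k X^j *)
Definition lie_bivector X pi : M -> 'M[R]_n := fun m =>
  let c := chart_at A m in
  let J := jacobian (vloc c X) (cmap c m) in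
  'D_(X m) (bloc c pi) (cmap c m) - J^T *m pi m - pi m *m J.

Definition bpair pi al be : M -> R :=
  fun m => ((al m)^T *m pi m *m be m) 0 0.

Definition sharp pi al : M -> 'rV[R]_n := fun m => (al m)^T *m pi m.

Definition hamvf pi f : M -> 'rV[R]_n := sharp pi (dfun f).

Definition pbracket pi f g : M -> R := bpair pi (dfun f) (dfun g).

Definition form_bracket pi al be : M -> 'cV[R]_n := fun m =>
  lie_form (sharp pi al) be m - lie_form (sharp pi be) al m
  - dfun (bpair pi al be) m.

Record is_poisson pi : Prop := {
  poisson_smooth : smooth_bivector pi;
  poisson_skew : forall m, (pi m)^T = - pi m;
  poisson_jacobi : forall f g h,
    smooth_fun A f -> smooth_fun A g -> smooth_fun A h ->
    forall m, pbracket pi f (pbracket pi g h) m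
            + pbracket pi g (pbracket pi h f) m
            + pbracket pi h (pbracket pi f g) m = 0 }.

(* [fst] is the projection tau_M : TM -> M; iT1 and iT2 are i_T on 1-forms and
   on 2-forms. *)
Definition iT1 al : M * 'rV[R]_n -> R := fun v => (v.2 *m al v.1) 0 0.

Definition iT2 (w : M -> 'M[R]_n) : M * 'rV[R]_n -> 'cV[R]_(n + n) := fun v =>
  (v.2 *m w v.1 *m (tangent_map (tangent_atlas A) A fst v)^T)^T.

End Tensors.

Section TangentLift.
Context {R : realType} {n : nat} {M : Type}.

Record is_tangent_lift (A : atlas R n M) (pi : M -> 'M[R]_n)
    (piT : M * 'rV[R]_n -> 'M[R]_(n + n)) : Prop := {
  tangent_lift_poisson : is_poisson (tangent_atlas A) piT;
  tangent_lift_forms : forall al be, smooth_form A al -> smooth_form A be ->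
    forall v, pbracket (tangent_atlas A) piT (iT1 al) (iT1 be) v
            = iT1 (form_bracket A pi al be) v;
  tangent_lift_form_fun : forall al (f : M -> R),
    smooth_form A al -> smooth_fun A f ->
    forall v, pbracket (tangent_atlas A) piT (iT1 al) (f \o fst) v
            = (sharp pi al v.1 *m dfun A f v.1) 0 0;
  tangent_lift_funs : forall f g : M -> R, smooth_fun A f -> smooth_fun A g ->
    forall v, pbracket (tangent_atlas A) piT (f \o fst) (g \o fst) v = 0 }.

End TangentLift.

Section LieGroups.
Context {R : realType} {d : nat} {G : groupType}.
Variable AG : atlas R d G.

Record is_lie_group : Prop := {
  lie_group_manifold : is_manifold AG;
  lie_group_mul :
    smooth_map (prod_atlas AG AG) AG (fun p : G * G => (p.1 * p.2)%g);
  lie_group_inv : smooth_map AG AG (fun g : G => (g^-1)%g) }.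

(* The Lie algebra is 'rV_d = T_1 G. *)
Definition right_invariant (xi : 'rV[R]_d) : G -> 'rV[R]_d :=
  fun g => xi *m tangent_map AG AG (fun h : G => (h * g)%g) 1%g.

Definition lie_bracket (xi eta : 'rV[R]_d) : 'rV[R]_d :=
  vbracket AG (right_invariant xi) (right_invariant eta) 1%g.

Definition is_exp (E : 'rV[R]_d -> G) : Prop := forall xi,
  [/\ smooth_curve AG (fun t : R => E (t *: xi)),
      forall s t : R, E ((s + t) *: xi) = (E (s *: xi) * E (t *: xi))%g &
      'D_1 (fun t : R => cmap (chart_at AG 1%g) (E (t *: xi))) 0 = xi].

Record is_poisson_lie_group (piG : G -> 'M[R]_d) : Prop := {
  plg_lie_group : is_lie_group;
  plg_poisson : is_poisson AG piG;
  plg_multiplicative : forall g h : G,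
    let Lg := tangent_map AG AG (fun x : G => (g * x)%g) h in
    let Rh := tangent_map AG AG (fun x : G => (x * h)%g) g in
    piG (g * h)%g = Lg^T *m piG h *m Lg + Rh^T *m piG g *m Rh }.

(* delta(xi) = (L_X piG)(1) does not depend on the choice of X with X(1) = xi,
   because a multiplicative piG vanishes at 1. *)
Definition cocycle (piG : G -> 'M[R]_d) (xi : 'rV[R]_d) : 'M[R]_d :=
  lie_bivector AG (right_invariant xi) piG 1%g.

End LieGroups.

Section Actions.
Context {R : realType} {d n : nat} {G : groupType} {M : Type}.
Variables (AG : atlas R d G) (A : atlas R n M).

Record is_action (Phi : G -> M -> M) : Prop := {
  action1 : forall m, Phi 1%g m = m;
  actionM : forall g h m, Phi (g * h)%g m = Phi g (Phi h m);
  action_smooth :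
    smooth_map (prod_atlas AG A) A (fun p : G * M => Phi p.1 p.2) }.

(* d/dt at t = 0 of Psi (exp (t xi)) m, as an element of T_m M *)
Definition generator (E : 'rV[R]_d -> G) (Psi : G -> M -> M) (xi : 'rV[R]_d) :
    M -> 'rV[R]_n :=
  fun m => 'D_1 (fun t : R => cmap (chart_at A m) (Psi (E (t *: xi)) m)) 0.

Definition tangent_action (Phi : G -> M -> M) (g : G)
    (v : M * 'rV[R]_n) : M * 'rV[R]_n :=
  (Phi g v.1, v.2 *m tangent_map A A (Phi g) v.1).

Definition wedge (a b : 'cV[R]_n) : 'M[R]_n := a *m b^T - b *m a^T.

(* (phi /\ phi)(B) where B = sum_(i < j) B_ij e_i /\ e_j *)
Definition wedge_map (phi : 'rV[R]_d -> M -> 'cV[R]_n) (B : 'M[R]_d) :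
    M -> 'M[R]_n :=
  fun m => \sum_(i < d) \sum_(j < d | (i < j)%N)
    B i j *: wedge (phi (delta_mx 0 i) m) (phi (delta_mx 0 j) m).

Record is_inf_momentum_map (E : 'rV[R]_d -> G) (piG : G -> 'M[R]_d)
    (pi : M -> 'M[R]_n) (Phi : G -> M -> M)
    (phi : 'rV[R]_d -> M -> 'cV[R]_n) : Prop := {
  imm_smooth : forall xi, smooth_form A (phi xi);
  imm_linear : forall m, linear (fun xi => phi xi m);
  imm_bracket : forall xi eta m,
    phi (lie_bracket AG xi eta) m = form_bracket A pi (phi xi) (phi eta) m;
  imm_d : forall xi m,
    dform A (phi xi) m = wedge_map phi (cocycle AG piG xi) m;
  imm_generator : forall xi m,
    generator E Phi xi m = sharp pi (phi xi) m }.

Definition component (J : M -> 'cV[R]_d) (xi : 'rV[R]_d) : M -> R :=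
  fun m => (xi *m J m) 0 0.

Record is_hamiltonian (pi : M -> 'M[R]_n) (psi : 'rV[R]_d -> M -> 'rV[R]_n)
    (J : M -> 'cV[R]_d) : Prop := {
  ham_smooth : smooth_fun A J;
  ham_generator : forall xi m, psi xi m = hamvf A pi (component J xi) m;
  ham_poisson : forall xi eta m,
    pbracket A pi (component J xi) (component J eta) m
    = component J (lie_bracket AG xi eta) m }.

End Actions.

(* Main.v *)
Require Import Defs.
From HB Require Import structures.
From mathcomp Require Import all_boot all_order all_algebra.
From mathcomp Require Import all_classical all_reals all_analysis.
From mathcomp Require Import ring.
Import Order.TTheory GRing.Theory Num.Theory numFieldNormedType.Exports.

(** In coordinates (x, w) of TM the complete lift of a vector field X of M is
    (X, D_w X), and that of a 1-form al is (D_w al, al). The first part of the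
    theorem holds because both sides are the complete lift of pi#(phi xi).

    On the left, the flow of xi acts on TM by its x-derivative, so the second
    component of the generator is the t-derivative of an x-derivative of the
    flow. Second derivatives commute ([derive_commute]), hence it is D_w of the
    generator on M: this is [generator_tangent_action].

    On the right, d (i_T al) is the complete lift of al up to terms in the
    antisymmetrized derivative of al, and these are exactly - i_T d al
    ([complete_lift_form]). It remains to see that pi_TM maps complete lifts of
    forms to complete lifts of vector fields. The defining brackets of pi_TM
    involve global functions and forms, so one needs enough of those: bump
    functions are built from exp(-1/s) and extended by zero, which preserves
    smoothness because the manifold is Hausdorff ([smooth_extension]). With them
    one prescribes the differentials of f o tau and of i_T al at a given vector,
    and reads off the coordinates of pi_TM ([tangent_lift_coords]); the claim is
    then the Leibniz rule ([sharp_complete_lift]).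

    The second part follows: when the forms phi xi are closed the correction
    term vanishes, and the bracket of the components of c is the defining
    bracket {i_T al, i_T be} = i_T [al, be] combined with the bracket condition
    on phi. *)

Set Implicit Arguments.
Unset Strict Implicit.
Unset Printing Implicit Defensive.

Local Open Scope classical_set_scope.
Local Open Scope ring_scope.

(** * Differentiation of matrix-valued functions *)

Section Differentiation.
Context {R : realType} {V : normedModType R}.

Lemma near_eq_differentiable {W : normedModType R} (f g : V -> W) (x : V) :
  (\near x, f x = g x) -> differentiable f x -> differentiable g x.
Proof.
move=> fg df; have fgx := nbhs_singleton fg.
have [dc /eqaddoP dfo] := (diff_locallyP x f).1 df.
have dgo : g \o shift x = cst (g x) + 'd f x +o_ 0 id.
  apply/eqaddoP => e e0; have := dfo e e0; apply: filter_app.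
  have : \forall y \near 0, f (y + x) = g (y + x).
    move: fg; rewrite (near_shift 0)/= => h.
    by near=> y; rewrite -[x]subr0; near: y.
  by apply: filterS => y /= fgy; rewrite !fctE /= fgy fgx.
have dE := diff_unique dc dgo.
by apply/diff_locallyP; rewrite dE.
Unshelve. all: by end_near. Qed.

Lemma differentiable_mx {m n : nat} (f : V -> 'M[R]_(m, n)) (x : V) :
  (forall i j, differentiable (fun y => f y i j) x) -> differentiable f x.
Proof.
move=> df.
have -> : f = \sum_(i < m) \sum_(j < n) (fun y => f y i j *: delta_mx i j).
  apply/funext => y; rewrite fct_sumE [LHS]matrix_sum_delta.
  by apply: eq_bigr => i _; rewrite fct_sumE.
apply: differentiable_sum => i; apply: differentiable_sum => j.
exact: differentiableZl.
Qed.

Lemma differentiable_entry {m n : nat} (f : V -> 'M[R]_(m, n)) i j (x : V) :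
  differentiable f x -> differentiable (fun y => f y i j) x.
Proof.
move=> df; have dc := differentiable_coord (f x) i j.
exact: (differentiable_comp df dc).
Qed.

Lemma derive_entry {m n : nat} (f : V -> 'M[R]_(m, n)) i j (x v : V) :
  differentiable f x -> 'D_v f x i j = 'D_v (fun y => f y i j) x.
Proof. by move=> df; rewrite derive_mx ?mxE//; exact: diff_derivable. Qed.

Lemma derive_chain {V' W : normedModType R} (f : V -> V') (g : V' -> W)
    (x v : V) :
  differentiable f x -> differentiable g (f x) ->
  'D_v (g \o f) x = 'D_('D_v f x) g (f x).
Proof.
move=> df dg; rewrite !deriveE//; last exact: differentiable_comp.
by rewrite diff_comp.
Qed.

Lemma differentiable_mulmx {m n p : nat} (f : V -> 'M[R]_(m, n))
    (g : V -> 'M[R]_(n, p)) (x : V) :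
  differentiable f x -> differentiable g x ->
  differentiable (fun y => f y *m g y) x.
Proof.
move=> df dg; apply: differentiable_mx => i j.
have -> : (fun y => (f y *m g y) i j) =
    \sum_k (fun y => f y i k * g y k j).
  by apply/funext => y; rewrite fct_sumE mxE.
apply: differentiable_sum => k.
by apply: differentiableM; apply: differentiable_entry.
Qed.

Lemma derive_mulmx {m n p : nat} (f : V -> 'M[R]_(m, n))
    (g : V -> 'M[R]_(n, p)) (x v : V) :
  differentiable f x -> differentiable g x ->
  'D_v (fun y => f y *m g y) x = 'D_v f x *m g x + f x *m 'D_v g x.
Proof.
move=> df dg; apply/matrixP => i j.
rewrite derive_entry; last exact: differentiable_mulmx.
have -> : (fun y => (f y *m g y) i j) =
    \sum_k (fun y => f y i k * g y k j).
  by apply/funext => y; rewrite fct_sumE mxE.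
rewrite derive_sum => [|k]; last first.
  by apply/diff_derivable/differentiableM; apply: differentiable_entry.
rewrite !mxE -big_split /=; apply: eq_bigr => k _.
rewrite deriveM; try exact/diff_derivable/differentiable_entry.
by rewrite !derive_entry// addrC; congr (_ + _); rewrite mulrC.
Qed.

Lemma differentiable_trmx {m n : nat} (f : V -> 'M[R]_(m, n)) (x : V) :
  differentiable f x -> differentiable (fun y => (f y)^T) x.
Proof.
move=> df; apply: differentiable_mx => i j.
under [X in differentiable X _]funext do rewrite mxE.
exact: differentiable_entry.
Qed.

Lemma derive_trmx {m n : nat} (f : V -> 'M[R]_(m, n)) (x v : V) :
  differentiable f x -> 'D_v (fun y => (f y)^T) x = ('D_v f x)^T.
Proof.
move=> df; apply/matrixP => i j.
rewrite derive_entry ?mxE ?derive_entry//; last exact: differentiable_trmx.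
by congr ('D_v _ x); apply/funext => y; rewrite mxE.
Qed.

Lemma differentiable_row_mx {m n p : nat} (f : V -> 'M[R]_(m, n))
    (g : V -> 'M[R]_(m, p)) (x : V) :
  differentiable f x -> differentiable g x ->
  differentiable (fun y => row_mx (f y) (g y)) x.
Proof.
move=> df dg; apply: differentiable_mx => i j.
case: (split_ordP j) => k ->.
  under [X in differentiable X _]funext do rewrite row_mxEl.
  exact: differentiable_entry.
under [X in differentiable X _]funext do rewrite row_mxEr.
exact: differentiable_entry.
Qed.

Lemma derive_row_mx {m n p : nat} (f : V -> 'M[R]_(m, n))
    (g : V -> 'M[R]_(m, p)) (x v : V) :
  differentiable f x -> differentiable g x ->
  'D_v (fun y => row_mx (f y) (g y)) x = row_mx ('D_v f x) ('D_v g x).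
Proof.
move=> df dg; apply/matrixP => i j.
rewrite derive_entry; last exact: differentiable_row_mx.
case: (split_ordP j) => k ->.
  rewrite row_mxEl derive_entry//.
  by congr ('D_v _ x); apply/funext => y; rewrite row_mxEl.
rewrite row_mxEr derive_entry//.
by congr ('D_v _ x); apply/funext => y; rewrite row_mxEr.
Qed.

End Differentiation.

Section Jacobians.
Context {R : realType}.

Lemma jacobian_comp {m n p : nat} (f : 'rV[R]_m -> 'rV[R]_n)
    (g : 'rV[R]_n -> 'rV[R]_p) x :
  differentiable f x -> differentiable g (f x) ->
  jacobian (g \o f) x = jacobian f x *m jacobian g (f x).
Proof.
move=> df dg; apply/row_matrixP => i.
rewrite !rowE mulmxA -(deriveEjacobian _ df).
have dgf := differentiable_comp df dg.
by rewrite -(deriveEjacobian _ dgf) -(deriveEjacobian _ dg) derive_chain.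
Qed.

Lemma near_eq_jacobian {m n : nat} (f g : 'rV[R]_m -> 'rV[R]_n) x :
  (\near x, f x = g x) -> differentiable f x -> jacobian f x = jacobian g x.
Proof.
move=> fg df; have dg := near_eq_differentiable fg df.
apply/row_matrixP => i.
rewrite [LHS]rowE [RHS]rowE -[LHS](deriveEjacobian _ df).
by rewrite -[RHS](deriveEjacobian _ dg); exact: near_eq_derive.
Qed.

Lemma jacobian_id {n : nat} x : jacobian (@id 'rV[R]_n) x = 1%:M.
Proof.
apply/row_matrixP => i.
have did : differentiable (@id 'rV[R]_n) x by exact: ex_diff.
rewrite [LHS]rowE -[LHS](deriveEjacobian _ did).
by rewrite derive_id rowE mulmx1.
Qed.

Lemma derive_row_mxr {d n : nat} {W : normedModType R} (H : 'rV[R]_(d + n) -> W)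
    (g : 'rV[R]_d) (x u : 'rV[R]_n) :
  'D_(row_mx 0 u) H (row_mx g x) = 'D_u (fun y => H (row_mx g y)) x.
Proof.
rewrite /derive; set p := fun h => _; set q := fun h => _.
suff -> : p = q by []; apply/funext => h; rewrite /p /q /=.
by rewrite scale_row_mx scaler0 add_row_mx add0r.
Qed.

End Jacobians.

(** * Functions of class C^k and symmetry of second derivatives *)

Section CkTheory.
Context {R : realType} {V : normedModType R}.
Implicit Types U : set V.

Lemma Ck_sub {W : normedModType R} k U U' (f : V -> W) :
  U' `<=` U -> Ck k U f -> Ck k U' f.
Proof.
move=> sU; elim: k f => [|k IH] f /=; first by move=> h x /sU /h.
by move=> [df dk]; split=> [x /sU /df //|v]; exact: IH.
Qed.

Lemma CkW {W : normedModType R} k U (f : V -> W) : Ck k.+1 U f -> Ck k U f.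
Proof.
elim: k f => [|k IH] f [df dk].
  by move=> x /df; exact: differentiable_continuous.
by split=> // v; exact: IH.
Qed.

Lemma Ck_setU {W : normedModType R} k U U' (f : V -> W) :
  Ck k U f -> Ck k U' f -> Ck k (U `|` U') f.
Proof.
elim: k f => [|k IH] f /=; first by move=> fU fU' x [/fU|/fU'].
by move=> [d h] [d' h']; split=> [x [/d|/d']//|v]; exact: IH.
Qed.

Lemma Ck_eq {W : normedModType R} k U (f g : V -> W) : open U ->
  (forall x, U x -> f x = g x) -> Ck k U f -> Ck k U g.
Proof.
move=> oU; elim: k f g => [|k IH] f g fg /=.
  move=> cf x Ux; rewrite /prop_for /continuous_at -(fg x Ux).
  apply: cvg_trans (cf x Ux); apply: near_eq_cvg.
  by apply: filterS (open_nbhs_nbhs (conj oU Ux)) => y /fg.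
have nfg x : U x -> \near x, f x = g x.
  by move=> Ux; apply: filterS (open_nbhs_nbhs (conj oU Ux)) => y /fg.
move=> [df dk]; split=> [x Ux|v].
  exact: near_eq_differentiable (nfg x Ux) (df x Ux).
apply: IH (dk v) => x Ux; exact: near_eq_derive (nfg x Ux).
Qed.

Lemma Ck_cst {W : normedModType R} k U (a : W) : Ck k U (fun _ => a).
Proof.
elim: k a => [|k IH] a /=; first by move=> x _; exact: cvg_cst.
split=> [x _|v]; first exact: differentiable_cst.
have -> : 'D_v (fun _ : V => a) = (fun _ : V => 0 : W); last exact: IH.
by apply/funext => x; exact: derive_cst.
Qed.

Lemma Ck_mx {m n : nat} k U (f : V -> 'M[R]_(m, n)) : open U ->
  Ck k U f <-> (forall i j, Ck k U (fun x => f x i j)).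
Proof.
move=> oU; elim: k f => [|k IH] f /=.
  split=> [cf i j x Ux|cf x Ux].
    exact: (continuous_comp (cf x Ux) (@coord_continuous _ _ _ i j _)).
  move=> A [P Pf PA].
  have : \forall y \near x, forall i j, P i j (f y i j).
    apply: filter_forall => i; apply: filter_forall => j.
    exact: (cf i j x Ux _ (Pf i j)).
  by apply: filterS => y Py; apply: PA => i j; exact: Py.
split=> [[df dk] i j|h].
  split=> [x /df|v]; first exact: differentiable_entry.
  have /(_ i j) := (IH _).1 (dk v).
  by apply: Ck_eq => // x /df fx; rewrite derive_entry.
split=> [x Ux|v]; first by apply: differentiable_mx => i j; exact: (h i j).1.
apply/IH => i j; have [dij /(_ v)] := h i j.
apply: Ck_eq => // x Ux; rewrite derive_entry//.
by apply: differentiable_mx => i' j'; exact: (h i' j').1.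
Qed.

Lemma CkD {W : normedModType R} k U (f g : V -> W) : open U ->
  Ck k U f -> Ck k U g -> Ck k U (fun x => f x + g x).
Proof.
move=> oU; elim: k f g => [|k IH] f g /=.
  by move=> cf cg x Ux; apply: continuousD; [exact: cf|exact: cg].
move=> [df hf] [dg hg]; split=> [x Ux|v].
  by apply: differentiableD; [exact: df|exact: dg].
apply: Ck_eq (IH _ _ (hf v) (hg v)) => // x Ux.
by rewrite deriveD//; apply: diff_derivable; [exact: df|exact: dg].
Qed.

Lemma CkM k U (f g : V -> R) : open U ->
  Ck k U f -> Ck k U g -> Ck k U (fun x => f x * g x).
Proof.
move=> oU; elim: k f g => [|k IH] f g.
  by move=> /= cf cg x Ux; apply: continuousM; [exact: cf|exact: cg].
move=> fk gk; have [/= df hf] := fk; have [/= dg hg] := gk.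
split=> [x Ux|v].
  by apply: differentiableM; [exact: df|exact: dg].
have h1 := IH _ _ (CkW fk) (hg v); have h2 := IH _ _ (CkW gk) (hf v).
apply: Ck_eq (CkD oU h1 h2) => // x Ux.
by rewrite deriveM//; apply: diff_derivable; [exact: df|exact: dg].
Qed.

Lemma Ck_sum {I : Type} (r : seq I) k U (f : I -> V -> R) : open U ->
  (forall i, Ck k U (f i)) -> Ck k U (fun x => \sum_(i <- r) f i x).
Proof.
move=> oU h; elim: r => [|i r IH].
  by apply: Ck_eq (Ck_cst k U 0) => // x _; rewrite big_nil.
by apply: Ck_eq (CkD oU (h i) IH) => // x _; rewrite big_cons.
Qed.

Lemma Ck_mulmx {m n p : nat} k U (f : V -> 'M[R]_(m, n))
    (g : V -> 'M[R]_(n, p)) : open U ->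
  Ck k U f -> Ck k U g -> Ck k U (fun x => f x *m g x).
Proof.
move=> oU /Ck_mx -/(_ oU) hf /Ck_mx -/(_ oU) hg; apply/Ck_mx => // i j.
have h : Ck k U (fun x => \sum_k f x i k * g x k j).
  by apply: Ck_sum => // l; exact: CkM.
by apply: Ck_eq h => // x _; rewrite mxE.
Qed.

Lemma Ck_trmx {m n : nat} k U (f : V -> 'M[R]_(m, n)) : open U ->
  Ck k U f -> Ck k U (fun x => (f x)^T).
Proof.
move=> oU /Ck_mx -/(_ oU) hf; apply/Ck_mx => // i j.
by apply: Ck_eq (hf j i) => // x _; rewrite mxE.
Qed.

Lemma Ck_comp {n : nat} k U (U' : set 'rV[R]_n) (f : V -> 'rV[R]_n)
    (g : 'rV[R]_n -> R) : open U -> (forall x, U x -> U' (f x)) ->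
  Ck k U f -> Ck k U' g -> Ck k U (fun x => g (f x)).
Proof.
move=> oU UU'; elim: k g => [|k IH] g.
  move=> /= cf cg x Ux; apply: (continuous_comp (cf x Ux)).
  exact/cg/UU'.
move=> fk gk; have [/= df hf] := fk; have [/= dg hg] := gk.
split=> [x Ux|v].
  by apply: (differentiable_comp (df x Ux)); exact/dg/UU'.
(* The chain rule is written with the partial derivatives of g, to which the
   induction hypothesis applies. *)
have h : Ck k U (fun x => \sum_i 'D_v f x 0 i * 'D_(delta_mx 0 i) g (f x)).
  apply: Ck_sum => // i; apply: CkM => //; last exact: IH (CkW fk) (hg _).
  exact: ((Ck_mx _ _ oU).1 (hf v)).
apply: Ck_eq h => // x Ux.
have dgx := dg _ (UU' x Ux).
rewrite (derive_chain _ (df x Ux) dgx) [in RHS](row_sum_delta ('D_v f x)).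
rewrite [RHS]deriveE// linear_sum; apply: eq_bigr => i _.
by rewrite linearZ; congr (_ * _); exact: deriveE.
Qed.

(** Young's argument: by two applications of the mean value theorem, the second
    difference of a C^2 function is a value of the mixed second derivative at a
    nearby point. *)
Lemma second_difference U (f : V -> R) (x u v : V) (e : R) :
  open U -> Ck 2 U f -> U x -> 0 < e ->
  \forall s \near 0^'+,
    `|(f (x + s *: u + s *: v) - f (x + s *: u) - f (x + s *: v) + f x) / s ^+ 2
      - 'D_u ('D_v f) x| < e.
Proof.
move=> oU [df /(_ v)[dfv /(_ u) cuv]] Ux e0.
have [r /= r0 xr] : exists2 r, 0 < r & ball x r `<=`
    [set y | U y /\ `|'D_u ('D_v f) y - 'D_u ('D_v f) x| < e].
  have : \forall y \near x, U y /\ `|'D_u ('D_v f) y - 'D_u ('D_v f) x| < e.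
    apply: filterI; first exact: open_nbhs_nbhs.
    exact: (cvgrPdistC_lt _ _).1 (cuv x Ux) e e0.
  by move=> /nbhs_ballP[r r0 xr]; exists r.
pose N := `|u| + `|v| + 1.
have N0 : 0 < N by rewrite ltr_wpDl// addr_ge0.
have near_x a b s : 0 < s -> s < r / N -> 0 <= a <= s -> 0 <= b <= s ->
    ball x r (x + a *: u + b *: v).
  move=> s0 sr /andP[a0 as_] /andP[b0 bs].
  rewrite -ball_normE /= -addrA opprD addNKr normrN.
  rewrite (le_lt_trans (ler_normD _ _))// !normrZ !ger0_norm//.
  rewrite (@le_lt_trans _ _ (s * N))//; last by rewrite -ltr_pdivlMr.
  rewrite /N mulrDr mulrDr mulr1 (@le_trans _ _ (s * `|u| + s * `|v|))//.
    by rewrite lerD// ler_wpM2r.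
  by rewrite lerDl ltW.
have line (W : normedModType R) (g : V -> W) (y w : V) (t : R) :
    differentiable g (y + t *: w) ->
    is_derive t 1 (fun t => g (y + t *: w)) ('D_w g (y + t *: w)).
  move=> dg; have dgw : derivable g (y + t *: w) w by exact: diff_derivable.
  have E : (fun h => h^-1 *: (((fun t => g (y + t *: w)) \o shift t) (h *: 1)
        - g (y + t *: w))) =
      (fun h => h^-1 *: ((g \o shift (y + t *: w)) (h *: w) - g (y + t *: w))).
    apply/funext => h /=; rewrite [h *: 1]mulr1 scalerDl.
    by rewrite addrCA.
  by apply: DeriveDef; [rewrite /derivable E|rewrite /derive E].
near=> s.
have s0 : 0 < s by near: s; exact: nbhs_right_gt.
have sr : s < r / N by near: s; apply: nbhs_right_lt; rewrite divr_gt0.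
have inU a b : 0 <= a <= s -> 0 <= b <= s -> U (x + a *: u + b *: v).
  by move=> ha hb; have [] := xr _ (near_x a b s s0 sr ha hb).
have s00 : 0 <= (0 : R) <= s by rewrite lexx ltW.
have ss : 0 <= s <= s by rewrite lexx andbT ltW.
have itvW (t : R) : t \in `[0, s] -> 0 <= t <= s by rewrite in_itv.
have itvoW (t : R) : t \in `]0, s[ -> 0 <= t <= s.
  by rewrite in_itv/= => /andP[? ?]; rewrite !ltW.
have dg (t : R) : 0 <= t <= s ->
    is_derive t 1 (fun t => f (x + s *: u + t *: v) - f (x + t *: v))
     ('D_v f (x + s *: u + t *: v) - 'D_v f (x + t *: v)).
  move=> ts; apply: is_deriveB; apply: line; apply: df; first exact: inU.
  by have := inU 0 t s00 ts; rewrite scale0r addr0.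
have cg := derivable_within_continuous
  (fun t h => @ex_derive _ _ _ _ _ _ _ (dg t (itvW t h))).
have [t /itvoW ts gt] := MVT s0 (fun t h => dg t (itvoW t h)) cg.
have dh (a : R) : 0 <= a <= s ->
    is_derive a 1 (fun a => 'D_v f (x + t *: v + a *: u))
      ('D_u ('D_v f) (x + t *: v + a *: u)).
  by move=> as_; apply: line; apply: dfv; rewrite addrAC; exact: inU.
have ch := derivable_within_continuous
  (fun t h => @ex_derive _ _ _ _ _ _ _ (dh t (itvW t h))).
have [a /itvoW as_ ha] := MVT s0 (fun t h => dh t (itvoW t h)) ch.
rewrite (_ : _ / _ = 'D_u ('D_v f) (x + a *: u + t *: v)).
  by have [] := xr _ (near_x a t s s0 sr as_ ts).
move: gt ha; rewrite !scale0r !addr0 !subr0 => gt ha.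
apply: (canLR (mulfK _)); first by rewrite expf_neq0// gt_eqF.
rewrite [x + t *: v + s *: u]addrAC [x + t *: v + a *: u]addrAC in ha.
rewrite expr2 mulrA -ha -gt; ring.
Unshelve. all: by end_near. Qed.

(** The second difference is symmetric in u and v. *)
Lemma derive_commute U (f : V -> R) (x u v : V) :
  open U -> Ck 2 U f -> U x -> 'D_u ('D_v f) x = 'D_v ('D_u f) x.
Proof.
move=> oU f2 Ux; apply/eqP; rewrite -subr_eq0 -normr_le0.
apply/ler_addgt0Pl => e e0; rewrite addr0.
have e20 : 0 < e / 2 by rewrite divr_gt0.
have [s [h1 h2]] := filter_ex (filterI (second_difference u v oU f2 Ux e20)
  (second_difference v u oU f2 Ux e20)).
rewrite [x + _ + s *: u]addrAC [_ - f (x + s *: v) - _]addrAC in h2.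
rewrite distrC in h1.
rewrite (splitr e) -(subrKA ((f (x + s *: u + s *: v) - f (x + s *: u) -
  f (x + s *: v) + f x) / s ^+ 2)).
by rewrite (le_trans (ler_normD _ _))// lerD// ltW.
Qed.

End CkTheory.

(** * A smooth bump function *)

Section FlatFunction.
Context {R : realType}.
Implicit Types s : R.

(** The functions s^(-k) exp(-1/s) extended by 0 to s <= 0. They are kept as a
    family because the span of the family is stable under derivation. *)
Definition flat (k : nat) s : R :=
  if 0 < s then s^-1 ^+ k * expR (- s^-1) else 0.

Lemma flat_ge0 k s : 0 <= flat k s.
Proof.
rewrite /flat; case: ifPn => // s0.
by rewrite mulr_ge0 ?expR_ge0// exprn_ge0// invr_ge0 ltW.
Qed.

(** From t^(k+2) / (k+2)! <= exp t at t = 1/s. A quadratic bound is what gives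
    the derivative 0 at the origin. *)
Lemma flat_le k s : flat k s <= (k.+2)`!%:R * s ^+ 2.
Proof.
rewrite /flat; case: ifPn => [s0|_]; last by rewrite mulr_ge0// sqr_ge0.
have t0 : 0 < s^-1 by rewrite invr_gt0.
rewrite expRN ler_pdivrMr ?expR_gt0//.
have := @expR_ge1Dxn _ s^-1 k.+1 (ltW t0).
have fac0 : 0 < (k.+2)`!%:R :> R by rewrite ltr0n fact_gt0.
move=> h; have {}h : s^-1 ^+ k.+2 / (k.+2)`!%:R <= expR s^-1.
  by apply: le_trans h; rewrite lerDr.
rewrite ler_pdivrMr// in h.
rewrite mulrAC -ler_pdivrMr ?exprn_gt0//.
by rewrite -exprVn -exprD addn2 mulrC.
Qed.

Lemma is_derive_flat k s :
  is_derive s 1 (flat k) (flat k.+2 s - k%:R * flat k.+1 s).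
Proof.
have [s0|s0|<-] := ltrgtP 0 s.
- have dV : is_derive s 1 GRing.inv (- s ^- 2).
    have s1 : s != 0 by rewrite gt_eqF.
    have := is_deriveV s1 (is_derive_id s 1).
    by rewrite /GRing.scale/= mulr1.
  apply: (@near_eq_is_derive _ _ _ (fun s => (s^-1 ^+ k) * expR (- s^-1))).
    by near=> t; rewrite /flat ifT//; near: t; exact: lt_nbhsr.
  have dX := is_deriveX k dV.
  have dE : is_derive s 1 (expR \o (fun s => - s^-1)) (expR (- s^-1) * s ^- 2).
    rewrite -[s ^- 2]opprK; apply: is_derive1_comp.
  have -> : (fun s => s^-1 ^+ k * expR (- s^-1)) =
      GRing.inv ^+ k * (expR \o (fun s => - s^-1)).
    by apply/funext => t; rewrite fctE /= exprfctE.
  apply: (@is_derive_eq _ _ _ _ _ _ _ _ (is_deriveM dX dE)).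
  rewrite /flat s0 /= /GRing.scale/= !exprfctE.
  case: k {dX} => [|k]; rewrite /= -!exprVn; set t := s^-1; set E := expR _.
    by ring.
  by rewrite !exprS; ring.
- apply: (@near_eq_is_derive _ _ _ (fun _ => 0)).
    near=> t; rewrite /flat ifF//; apply: le_gtF; apply: ltW.
    by near: t; exact: lt_nbhsl.
  by rewrite /flat le_gtF ?ltW// mulr0 subrr; exact: is_derive_cst.
- rewrite /flat ltxx mulr0 subrr.
  have h : (fun h : R =>
      h^-1 *: ((flat k \o shift 0) (h *: (1 : R)) - flat k 0)) @ 0^' -->
      (0 : R).
    apply/cvgr0Pnorm_le => e e0; near=> h.
    rewrite /= addr0 [h *: 1]mulr1 {2}/flat ltxx subr0 normrZ normfV.
    have h0 : h != 0 by near: h; exact: nbhs_dnbhs_neq.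
    rewrite ler_pdivrMl ?normr_gt0// (ger0_norm (flat_ge0 _ _)).
    rewrite (le_trans (flat_le k h))// -real_normK ?num_real// expr2 mulrCA.
    rewrite ler_wpM2l// -ler_pdivlMl ?ltr0n ?fact_gt0// ltW//.
    near: h; apply: dnbhs0_lt.
    by rewrite mulr_gt0// invr_gt0 ltr0n fact_gt0.
  apply: DeriveDef; first by apply/cvg_ex; exists 0.
  exact/cvg_lim.
Unshelve. all: by end_near. Qed.

Lemma differentiable_flat k s : differentiable (flat k) s.
Proof.
apply/derivable1_diffP; exact: (@ex_derive _ _ _ _ _ _ _ (is_derive_flat k s)).
Qed.

(** The induction is on the order of differentiability, for all members of the
    family at once, because the derivative of flat j involves flat j.+1 and
    flat j.+2. *)
Lemma Ck_flat_comp {V : normedModType R} k j (U : set V) (f : V -> R) :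
  open U -> Ck k U f -> Ck k U (fun x => flat j (f x)).
Proof.
move=> oU; elim: k j => [|k IH] j.
  move=> /= cf x Ux; apply: (continuous_comp (cf x Ux)).
  exact/differentiable_continuous/differentiable_flat.
move=> fk; have [/= df hf] := fk; split=> [x Ux|v].
  exact: (differentiable_comp (df x Ux) (differentiable_flat _ _)).
have h : Ck k U (fun x => 'D_v f x * (flat j.+2 (f x) +
    (- j%:R) * flat j.+1 (f x))).
  apply: CkM (hf v) _ => //; apply: CkD (IH _ (CkW fk)) _ => //.
  exact: CkM (Ck_cst _ _ _) (IH _ (CkW fk)).
apply: Ck_eq h => // x Ux.
rewrite (derive_chain _ (df x Ux) (differentiable_flat j (f x))).
rewrite [RHS]deriveE; last exact: differentiable_flat.
rewrite -['D_v f x in RHS]mulr1 [RHS]linearZ/=.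
rewrite -deriveE; last exact: differentiable_flat.
by have [_ ->] := is_derive_flat j (f x); rewrite mulNr.
Qed.

End FlatFunction.

Section Bump.
Context {R : realType} {n : nat}.

(** The bump flat 0 (e^2 - |x - x0|^2), with the Euclidean norm, normalized at
    x0. It is not constant near x0: its first derivatives vanish there because
    x0 is a critical point of |x - x0|^2, and this suffices to prescribe a
    1-jet at x0. *)
Lemma exists_bump (x0 : 'rV[R]_n) (e : R) : 0 < e ->
  exists chi : 'rV[R]_n -> R,
    [/\ smooth_on setT chi, chi x0 = 1, forall u, 'D_u chi x0 = 0 &
        forall x, chi x <> 0 -> `|x0 - x| <= e].
Proof.
move=> e0.
pose q x : R := e ^+ 2 + (- 1) * ((x - x0) *m (x - x0)^T) 0 0.
have dx x : differentiable (fun x => x - x0) x.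
  by apply: differentiableB; [exact: ex_diff|exact: differentiable_cst].
have dxx x : differentiable (fun x => (x - x0) *m (x - x0)^T) x.
  by apply: differentiable_mulmx => //; exact: differentiable_trmx.
have Dq u : 'D_u q x0 = 0.
  have dqq := differentiable_entry 0 0 (dxx x0).
  rewrite /q deriveD; last 2 first.
  - exact: derivable_cst.
  - by apply: derivableM; [exact: derivable_cst|exact: diff_derivable].
  rewrite derive_cst add0r deriveMl; last exact: diff_derivable.
  rewrite -derive_entry// derive_mulmx//; last exact: differentiable_trmx.
  by rewrite subrr trmx0 mul0mx mulmx0 addr0 mxE mulr0.
have Cq : smooth_on setT q.
  move=> k; apply: CkD; [exact: openT|exact: Ck_cst|].
  apply: CkM; [exact: openT|exact: Ck_cst|].
  have Cx : Ck k setT (fun x : 'rV[R]_n => x - x0).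
    case: k => [|k]; first by move=> x _; exact: differentiable_continuous.
    split=> // v; have -> : 'D_v (fun x : 'rV[R]_n => x - x0) = cst v.
      apply/funext => x; rewrite deriveB//.
      by rewrite derive_id derive_cst subr0.
    exact: Ck_cst.
  apply: (Ck_mx _ _ openT).1; apply: Ck_mulmx => //; first exact: openT.
  by apply: Ck_trmx => //; exact: openT.
have fe0 : 0 < flat 0 (e ^+ 2).
  by rewrite /flat exprn_gt0// expr0 mul1r expR_gt0.
have q0 : q x0 = e ^+ 2 by rewrite /q subrr mul0mx mxE mulr0 addr0.
exists (fun x => (flat 0 (e ^+ 2))^-1 * flat 0 (q x)); split.
- move=> k; apply: CkM; [exact: openT|exact: Ck_cst|].
  by apply: Ck_flat_comp; [exact: openT|exact: Cq].
- by rewrite q0 mulVf// gt_eqF.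
- move=> u; have dq : differentiable q x0 by have [] := Cq 1%N => + _; exact.
  have dfq := differentiable_comp dq (differentiable_flat 0 (q x0)).
  rewrite deriveMl; last exact: diff_derivable.
  rewrite (derive_chain _ dq (differentiable_flat 0 (q x0))) Dq.
  by rewrite derive0 mulr0.
- move=> x; apply: contra_notP => /negP; rewrite -ltNge => ex.
  suff q0x : q x <= 0 by rewrite [flat 0 (q x)]/flat le_gtF// mulr0.
  rewrite /q mulN1r subr_le0.
  have [[i j] /= xij] : exists ij, `|x0 - x| = `|(x0 - x) ij.1 ij.2|.
    by apply: mx_norm_neq0; rewrite gt_eqF// (lt_trans e0).
  rewrite ord1 in xij; rewrite mxE (bigD1 j)//=.
  rewrite ler_wpDr//.
    by apply: sumr_ge0 => l _; rewrite !mxE -expr2 sqr_ge0.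
  move: ex; rewrite xij !mxE -expr2 => ex.
  rewrite distrC in ex; rewrite -(real_normK (num_real (x 0 j - x0 0 j))).
  by rewrite lerXn2r ?nnegrE ?normr_ge0// ltW.
Qed.

End Bump.

(** * Changes of charts and extension by zero *)

Lemma smooth_differentiable {R : realType} {V W : normedModType R} (U : set V)
    (f : V -> W) x : smooth_on U f -> U x -> differentiable f x.
Proof. by move=> /(_ 1%N)[+ _]; exact. Qed.

Lemma smooth_jacobian {R : realType} {n k : nat} (U : set 'rV[R]_n)
    (f : 'rV[R]_n -> 'rV[R]_k) :
  open U -> smooth_on U f -> smooth_on U (jacobian f).
Proof.
move=> oU hf l; have [df /= dk] := hf l.+1; apply/Ck_mx => // i j.
apply: Ck_eq ((Ck_mx _ _ oU).1 (dk (delta_mx 0 i)) 0 j) => // x Ux.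
by rewrite mxE deriveE//; exact: df.
Qed.

Section Charts.
Context {R : realType} {n : nat} {M : Type}.
Variable A : atlas R n M.
Hypothesis hM : is_manifold A.
Implicit Types (c : chart R n M) (m : M).

Lemma cinvK c x : charts A c -> cimg c x ->
  cdom c (cinv c x) /\ cmap c (cinv c x) = x.
Proof. by move=> Ac [m cm <-]; rewrite (cmapK hM) ?inE. Qed.

Lemma cmapKE c m : charts A c -> cdom c m -> cinv c (cmap c m) = m.
Proof. by move=> Ac cm; rewrite (cmapK hM) ?inE. Qed.

Lemma near_overlap c c' m :
  charts A c -> charts A c' -> cdom c m -> cdom c' m ->
  \forall x \near cmap c m, (cmap c @` (cdom c `&` cdom c')) x.
Proof.
move=> Ac Ac' cm c'm; apply: open_nbhs_nbhs; split; last by exists m.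
exact: (open_overlap hM).
Qed.

Lemma near_cimg c m : charts A c -> cdom c m ->
  \forall x \near cmap c m, cimg c x.
Proof.
move=> Ac cm; apply: open_nbhs_nbhs; split; last by exists m.
exact: (open_cimg hM).
Qed.

Lemma differentiable_transition c c' m : charts A c -> charts A c' ->
  cdom c m -> cdom c' m -> differentiable (cmap c' \o cinv c) (cmap c m).
Proof.
move=> Ac Ac' cm c'm.
by apply: smooth_differentiable (smooth_transition hM Ac Ac') _; exists m.
Qed.

(** The cocycle relation from which all the changes of coordinates between
    preferred charts and other charts follow. *)
Lemma jacobian_transition c1 c2 c3 m :
  charts A c1 -> charts A c2 -> charts A c3 ->
  cdom c1 m -> cdom c2 m -> cdom c3 m ->
  jacobian (cmap c2 \o cinv c1) (cmap c1 m) *m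
    jacobian (cmap c3 \o cinv c2) (cmap c2 m) =
  jacobian (cmap c3 \o cinv c1) (cmap c1 m).
Proof.
move=> A1 A2 A3 m1 m2 m3.
have d12 := differentiable_transition A1 A2 m1 m2.
have E : (cmap c2 \o cinv c1) (cmap c1 m) = cmap c2 m by rewrite /= cmapKE.
have d23 := differentiable_transition A2 A3 m2 m3.
rewrite -E in d23 *; rewrite -(jacobian_comp d12 d23).
apply: near_eq_jacobian; last exact: differentiable_comp.
have := near_overlap A1 A2 m1 m2; apply: filterS => _ [m' [m'1 m'2] <-] /=.
by rewrite !cmapKE.
Qed.

Lemma jacobian_transition_id c m : charts A c -> cdom c m ->
  jacobian (cmap c \o cinv c) (cmap c m) = 1%:M.
Proof.
move=> Ac cm; have dc := differentiable_transition Ac Ac cm cm.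
rewrite -(jacobian_id (cmap c m)); apply: near_eq_jacobian => //.
by have := near_cimg Ac cm; apply: filterS => x /(cinvK Ac)[_ /=].
Qed.

Let c_at := chart_at_atlas hM.
Let d_at := chart_at_dom hM.

Lemma of_to_chart c c' m : charts A c -> charts A c' -> cdom c m -> cdom c' m ->
  of_chart A c m *m to_chart A c' m = jacobian (cmap c' \o cinv c) (cmap c m).
Proof. by move=> *; exact: jacobian_transition. Qed.

Lemma of_chartK c m : charts A c -> cdom c m ->
  of_chart A c m *m to_chart A c m = 1%:M.
Proof. by move=> *; rewrite of_to_chart// jacobian_transition_id. Qed.

Lemma to_chartK c m : charts A c -> cdom c m ->
  to_chart A c m *m of_chart A c m = 1%:M.
Proof.
by move=> *; rewrite [LHS]jacobian_transition// jacobian_transition_id.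
Qed.

Lemma to_chart_at m : to_chart A (chart_at A m) m = 1%:M.
Proof. exact: jacobian_transition_id. Qed.

Lemma of_chart_at m : of_chart A (chart_at A m) m = 1%:M.
Proof. exact: jacobian_transition_id. Qed.

Lemma floc_at al m : floc A (chart_at A m) al (cmap (chart_at A m) m) = al m.
Proof. by rewrite /floc cmapKE// of_chart_at mul1mx. Qed.

Lemma bloc_at pi m : bloc A (chart_at A m) pi (cmap (chart_at A m) m) = pi m.
Proof. by rewrite /bloc cmapKE// to_chart_at trmx1 mul1mx mulmx1. Qed.

Lemma vloc_sharp c pi al x : charts A c -> cimg c x ->
  vloc A c (sharp pi al) x = (floc A c al x)^T *m bloc A c pi x.
Proof.
move=> Ac cx; have [dx _] := cinvK Ac cx.
rewrite /vloc /sharp /floc /bloc trmx_mul !mulmxA.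
rewrite -[X in _ = X *m pi _ *m _]mulmxA.
by rewrite -trmx_mul to_chartK// trmx1 mulmx1.
Qed.

Lemma bpair_loc c pi al be x : charts A c -> cimg c x ->
  bpair pi al be (cinv c x) =
  ((floc A c al x)^T *m bloc A c pi x *m floc A c be x) 0 0.
Proof.
move=> Ac cx; have [dx _] := cinvK Ac cx.
rewrite -vloc_sharp// /vloc /sharp /floc mulmxA.
rewrite -[X in _ = (X *m be _) _ _]mulmxA.
by rewrite to_chartK// mulmx1.
Qed.

(** A compact subset of a chart is closed in the whole manifold because the
    manifold is Hausdorff: a point outside has a neighbourhood that misses a
    neighbourhood of each point of K, uniformly so by compactness. *)
Lemma mopen_compactC c (K : set 'rV[R]_n) : charts A c -> compact K ->
  K `<=` cimg c -> mopen A (~` (cdom c `&` cmap c @^-1` K)).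
Proof.
move=> Ac /compact_near_coveringP cK Kc c' Ac'.
rewrite openE => _ [m' [c'm' nm'] <-].
have near_neq : \forall x \near cmap c' m',
    K `<=` [set y | cinv c' x <> cinv c y].
  apply: (cK _ _ (fun x y => cinv c' x <> cinv c y)
    (nbhs_filter (cmap c' m'))) => y Ky; have [cy yE] := cinvK Ac (Kc _ Ky).
  have : m' <> cinv c y.
    by move=> m'y; apply: nm'; rewrite m'y; split=> //=; rewrite yE.
  move=> /(manifold_hausdorff hM)[U [U' [oU oU' Um' U'y UU']]].
  exists (cmap c @` (cdom c `&` U'), cmap c' @` (cdom c' `&` U)) => /=.
    split; apply: open_nbhs_nbhs; split.
    - exact: (oU' c Ac).
    - by exists (cinv c y).
    - exact: (oU c' Ac').
    - by exists m'.
  move=> [z x] [/= [p [cp U'p] <-] [q [c'q Uq] <-]].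
  rewrite !cmapKE// => qp; have : (U `&` U') q by split=> //; rewrite qp.
  by rewrite UU'.
move: near_neq (near_cimg Ac' c'm'); apply: filterS2 => x + [m'' c'm'' xE].
rewrite -xE => xK; rewrite cmapKE// in xK.
exists m'' => //; split=> // -[cm'' /= Km''].
by apply: (xK _ Km''); rewrite cmapKE.
Qed.

(** Extension by zero, seen in another chart c': the domain of c' is covered by
    two open sets, its overlap with c and the complement of the compact
    support. *)
Lemma smooth_extension {W : normedModType R} c c' (K : set 'rV[R]_n)
    (f : 'rV[R]_n -> W) : charts A c -> charts A c' -> compact K ->
  K `<=` cimg c -> smooth_on (cmap c' @` (cdom c' `&` cdom c)) f ->
  (forall m, cdom c' m -> ~ (cdom c m /\ K (cmap c m)) -> f (cmap c' m) = 0) ->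
  smooth_on (cimg c') f.
Proof.
move=> Ac Ac' cK Kc sf f0 k.
have oN := mopen_compactC Ac cK Kc Ac'.
apply: (@Ck_sub _ _ _ _ (cmap c' @` (cdom c' `&` cdom c) `|`
    cmap c' @` (cdom c' `&` ~` (cdom c `&` cmap c @^-1` K)))).
  move=> _ [m c'm <-]; have [cm|ncm] := pselect (cdom c m); [left|right].
    by exists m.
  by exists m => //; split=> // -[].
apply: Ck_setU; first exact: sf.
apply: Ck_eq (Ck_cst _ _ 0) => // _ [m [c'm nm] <-].
by rewrite f0.
Qed.

Lemma ex_compact_ball c m : charts A c -> cdom c m -> exists e, [/\ 0 < e,
  compact [set x | `|cmap c m - x| <= e] &
  [set x | `|cmap c m - x| <= e] `<=` cimg c].
Proof.
move=> Ac cm; have /nbhs_ballP[r /= r0 rc] := near_cimg Ac cm.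
exists (r / 2); split; first by rewrite divr_gt0.
  apply: bounded_closed_compact.
    exists (`|cmap c m| + r / 2); split; first exact: num_real.
    move=> t ht x /= xr; apply: le_trans (ltW ht).
    rewrite -[x](subKr (cmap c m)) (le_trans (ler_normB _ _))//.
    by rewrite lerD2l.
  rewrite (_ : [set _ | _] =
    (fun x => `|cmap c m - x|) @^-1` [set t | t <= r / 2])//.
  apply: closed_comp; last exact: closed_le.
  move=> x _; apply: continuous_comp; last exact: norm_continuous.
  by apply: continuousB; [exact: cst_continuous|].
move=> x /= xr; apply: rc; rewrite -ball_normE /=.
by rewrite (le_lt_trans xr)// gtr_pMr// invf_lt1// ltr1n.
Qed.

Lemma dfunE f m :
  differentiable (f \o cinv (chart_at A m)) (cmap (chart_at A m) m) ->
  forall u, 'D_u (f \o cinv (chart_at A m)) (cmap (chart_at A m) m) =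
    (u *m dfun A f m) 0 0.
Proof.
move=> df u; rewrite deriveE// [in LHS](row_sum_delta u) linear_sum mxE.
apply: eq_bigr => i _; rewrite linearZ [dfun _ _ _ _ _]mxE deriveE//.
Qed.

End Charts.

Lemma dfun_eq {R : realType} {n : nat} {M : Type} (A : atlas R n M) f m
    (a : 'cV[R]_n) :
  (forall u, 'D_u (f \o cinv (chart_at A m)) (cmap (chart_at A m) m) =
    (u *m a) 0 0) -> dfun A f m = a.
Proof.
move=> h; apply/colP => i; rewrite mxE h -rowE.
by rewrite mxE.
Qed.

(** * Global functions and forms with prescribed behaviour at a point *)

Section GlobalObjects.
Context {R : realType} {n : nat} {M : Type}.
Variable A : atlas R n M.
Hypothesis hM : is_manifold A.
Implicit Types (c : chart R n M) (m : M).

Let c_at := chart_at_atlas hM.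
Let d_at := chart_at_dom hM.

Lemma Ck_comp_transition c c' k (g : 'rV[R]_n -> R) :
  charts A c -> charts A c' -> Ck k setT g ->
  Ck k (cmap c' @` (cdom c' `&` cdom c)) (g \o (cmap c \o cinv c')).
Proof.
move=> Ac Ac' gk; have oU := open_overlap hM Ac' Ac.
exact: (Ck_comp oU (fun _ _ => I) (smooth_transition hM Ac' Ac k) gk).
Qed.

(** The witness is a linear function of the coordinates that vanishes at m, cut
    off by a bump; both vanishings, of this function and of the derivative of the
    bump, leave only its linear part in the differential. *)
Lemma exists_fun_with_differential m (a : 'cV[R]_n) :
  exists f, smooth_fun A f /\ dfun A f m = a.
Proof.
pose c := chart_at A m; have Ac : charts A c := c_at m.
have cm : cdom c m := d_at m.
have [e [e0 cK Kc]] := ex_compact_ball hM Ac cm.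
have [chi [schi chi1 dchi chiK]] := exists_bump (cmap c m) e0.
pose g x := chi x * ((x - cmap c m) *m a) 0 0.
have dx x : differentiable (fun x => x - cmap c m) x.
  by apply: differentiableB; [exact: ex_diff|exact: differentiable_cst].
have Dx x u : 'D_u (fun x => x - cmap c m) x = u.
  by rewrite deriveB// derive_id derive_cst subr0.
have dxa x : differentiable (fun x => (x - cmap c m) *m a) x.
  by apply: differentiable_mulmx => //; exact: differentiable_cst.
have sg : smooth_on setT g.
  move=> k; apply: CkM; [exact: openT|exact: schi|].
  apply: (Ck_mx _ _ openT).1; apply: Ck_mulmx; [exact: openT| |exact: Ck_cst].
  case: k => [|k]; first by move=> x _; exact: differentiable_continuous.
  split=> // v; rewrite (_ : 'D_v _ = fun _ => v); last by apply/funext => x.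
  exact: Ck_cst.
exists (fun p => if pselect (cdom c p) then g (cmap c p) else 0); split.
  move=> c' Ac'; apply: (smooth_extension hM Ac Ac' cK Kc).
    move=> k; apply: Ck_eq (Ck_comp_transition Ac Ac' (sg k)).
      exact: (open_overlap hM).
    move=> _ [p [c'p cp] <-] /=; rewrite (cmapKE hM)//.
    by case: pselect.
  move=> p c'p np; rewrite /= (cmapKE hM)//; case: pselect => // cp.
  suff -> : g (cmap c p) = 0 by [].
  apply: contra_notP np => gp; split=> //; apply: chiK => chi0; apply: gp.
  by rewrite /g chi0 mul0r.
apply: dfun_eq => u; rewrite -/c.
rewrite (@near_eq_derive _ _ _ _ g); last first.
  apply: (filterS _ (near_cimg hM Ac cm)) => x /(cinvK hM Ac)[cx xE] /=.
  by case: pselect => //= _; rewrite xE.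
have dchim : differentiable chi (cmap c m).
  exact: smooth_differentiable schi I.
rewrite deriveM; last 2 first.
- exact: diff_derivable.
- exact/diff_derivable/differentiable_entry.
rewrite chi1 dchi scaler0 addr0 scale1r -derive_entry//.
rewrite (derive_mulmx u (dx _) (differentiable_cst a _)).
by rewrite derive_cst mulmx0 addr0 Dx.
Qed.

(** A form that is constant in the chart, cut off by a bump. It keeps the value
    b and a vanishing derivative at m, so that i_T be has the differential
    (0, b) at any vector over m. *)
Lemma exists_stationary_form m (b : 'cV[R]_n) :
  exists be, [/\ smooth_form A be, be m = b &
  forall u, 'D_u (floc A (chart_at A m) be) (cmap (chart_at A m) m) = 0].
Proof.
pose c := chart_at A m; have Ac : charts A c := c_at m.
have cm : cdom c m := d_at m.
have [e [e0 cK Kc]] := ex_compact_ball hM Ac cm.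
have [chi [schi chi1 dchi chiK]] := exists_bump (cmap c m) e0.
pose be p : 'cV[R]_n := if pselect (cdom c p)
  then chi (cmap c p) *: (to_chart A c p *m b) else 0.
have be_in p : cdom c p -> be p = chi (cmap c p) *: (to_chart A c p *m b).
  by rewrite /be; case: pselect.
have be_out p : ~ cdom c p -> be p = 0 by rewrite /be; case: pselect.
have locE c' x : charts A c' -> cimg c' x -> cdom c (cinv c' x) ->
    floc A c' be x = chi (cmap c (cinv c' x)) *:
      (jacobian (cmap c \o cinv c') x *m b).
  move=> Ac' c'x cx; have [c'p xE] := cinvK hM Ac' c'x.
  rewrite /floc be_in//.
  rewrite -[LHS]scalemxAr; congr (_ *: _); rewrite [LHS]mulmxA; congr (_ *m _).
  by rewrite -[in RHS]xE; exact: of_to_chart.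
have locc x : cimg c x -> floc A c be x = chi x *: b.
  move=> cx; have [cp xE] := cinvK hM Ac cx; rewrite locE// xE.
  by rewrite -{2}xE (jacobian_transition_id hM Ac cp) mul1mx.
exists be; split.
- move=> c' Ac'; apply: (smooth_extension hM Ac Ac' cK Kc).
    have oU := open_overlap hM Ac' Ac.
    move=> k; apply/(Ck_mx _ _ oU) => i j.
    have h1 := Ck_comp_transition Ac Ac' (schi k).
    have h2 := Ck_mulmx oU (smooth_jacobian oU (smooth_transition hM Ac' Ac) k)
      (Ck_cst _ _ b).
    have h3 := (Ck_mx _ _ oU).1 h2 i j.
    apply: (Ck_eq oU _ (CkM oU h1 h3)) => _ [p [c'p cp] <-].
    have cp' : cdom c (cinv c' (cmap c' p)) by rewrite (cmapKE hM).
    by rewrite (locE _ _ Ac' _ cp'); [rewrite [RHS]mxE|exists p].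
  move=> p c'p np; rewrite /floc (cmapKE hM Ac' c'p).
  suff -> : be p = 0 by rewrite mulmx0.
  have [cp|ncp] := pselect (cdom c p); last by rewrite be_out.
  rewrite be_in//; suff -> : chi (cmap c p) = 0 by rewrite scale0r.
  by apply: contra_notP np => gp; split=> //; exact: chiK.
- by rewrite be_in// chi1 scale1r to_chart_at// mul1mx.
- move=> u.
  rewrite -/c (@near_eq_derive _ _ _ _ (fun x => chi x *: b)); last first.
    by apply: (filterS _ (near_cimg hM Ac cm)) => x; exact: locc.
  have dchim : differentiable chi (cmap c m).
    exact: smooth_differentiable schi I.
  rewrite deriveE; last exact: differentiableZl.
  by rewrite diffZl//= -deriveE// dchi scale0r.
Qed.

End GlobalObjects.

(** * The tangent lift of a bivector in coordinates *)

Section LinearDerivatives.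
Context {R : realType}.

Lemma derive_linear {V W : normedModType R} (f : {linear V -> W}) (x v : V) :
  continuous f -> 'D_v f x = f v.
Proof.
move=> cf; rewrite deriveE; last exact: linear_differentiable.
by rewrite diff_lin.
Qed.

Lemma derive_lsubmx {m n1 n2 : nat} (x v : 'M[R]_(m, n1 + n2)) :
  'D_v lsubmx x = lsubmx v.
Proof. by apply: derive_linear; exact: continuous_lsubmx. Qed.

Lemma derive_rsubmx {m n1 n2 : nat} (x v : 'M[R]_(m, n1 + n2)) :
  'D_v rsubmx x = rsubmx v.
Proof. by apply: derive_linear; exact: continuous_rsubmx. Qed.

Lemma trmx11 (X : 'M[R]_1) : X^T = X.
Proof. by apply/matrixP => i j; rewrite !ord1 mxE. Qed.

Lemma skew_form {n : nat} (P : 'M[R]_n) (a b : 'cV[R]_n) : P^T = - P ->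
  (a^T *m P *m b) 0 0 = - (b^T *m P *m a) 0 0.
Proof.
move=> skewP; have -> : a^T *m P *m b = (b^T *m P^T *m a)^T.
  by rewrite !trmx_mul !trmxK mulmxA.
by rewrite skewP mulmxN mulNmx !mxE.
Qed.

End LinearDerivatives.

Section TangentBundle.
Context {R : realType} {n : nat} {M : Type}.
Variable A : atlas R n M.
Hypothesis hM : is_manifold A.
Implicit Types (v : M * 'rV[R]_n) (al be : M -> 'cV[R]_n) (pi : M -> 'M[R]_n).

Local Notation TA := (tangent_atlas A).
Local Notation c_ v := (chart_at A v.1).
Local Notation x_ v := (cmap (c_ v) v.1).

Let c_at := chart_at_atlas hM.
Let d_at := chart_at_dom hM.

Lemma cmap_tangent_at v : cmap (chart_at TA v) v = row_mx (x_ v) v.2.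
Proof. by rewrite /= to_chart_at// mulmx1. Qed.

Lemma cimg_at m : cimg (chart_at A m) (cmap (chart_at A m) m).
Proof. by exists m. Qed.

Lemma differentiable_floc al m : smooth_form A al ->
  differentiable (floc A (chart_at A m) al) (cmap (chart_at A m) m).
Proof.
by move=> /(_ _ (c_at m))/smooth_differentiable; apply; exact: cimg_at.
Qed.

Lemma differentiable_bloc pi m : smooth_bivector A pi ->
  differentiable (bloc A (chart_at A m) pi) (cmap (chart_at A m) m).
Proof.
by move=> /(_ _ (c_at m))/smooth_differentiable; apply; exact: cimg_at.
Qed.

Lemma derive_floc al m u : smooth_form A al ->
  'D_u (floc A (chart_at A m) al) (cmap (chart_at A m) m) =
  (u *m jacobian (fun x => (floc A (chart_at A m) al x)^T)
     (cmap (chart_at A m) m))^T.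
Proof.
move=> sal; have dal := differentiable_floc m sal.
have dalT := differentiable_trmx dal.
by rewrite -(deriveEjacobian u dalT) derive_trmx// trmxK.
Qed.

Lemma dfun_pullback (f : M -> R) v : smooth_fun A f ->
  dfun TA (f \o fst) v = col_mx (dfun A f v.1) 0.
Proof.
move=> sf; apply: dfun_eq => w; rewrite cmap_tangent_at.
have df : differentiable (f \o cinv (c_ v)) (x_ v).
  by apply: smooth_differentiable (sf _ (c_at v.1)) _; exact: cimg_at.
have -> : (f \o fst) \o cinv (chart_at TA v) = (f \o cinv (c_ v)) \o lsubmx.
  by [].
rewrite derive_chain ?row_mxKl//; last exact: differentiable_lsubmx.
rewrite derive_lsubmx dfunE// -{2}[w]hsubmxK mul_row_col mulmx0 addr0.
by [].
Qed.

(** In the coordinates (x, w) of TM, i_T al is the function w . al(x). *)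
Lemma dfun_iT1 al v : smooth_form A al ->
  dfun TA (iT1 al) v =
  col_mx (jacobian (fun x => (floc A (c_ v) al x)^T) (x_ v) *m v.2^T) (al v.1).
Proof.
move=> sal; apply: dfun_eq => w; rewrite cmap_tangent_at.
have dal := differentiable_floc v.1 sal.
have -> : iT1 al \o cinv (chart_at TA v) =
    fun y => (rsubmx y *m floc A (c_ v) al (lsubmx y)) 0 0.
  by apply/funext => y; rewrite /iT1 /floc /= mulmxA.
set y0 := row_mx _ _.
have dl : differentiable (lsubmx : 'rV[R]_(n + n) -> _) y0.
  exact: differentiable_lsubmx.
have dr : differentiable (rsubmx : 'rV[R]_(n + n) -> _) y0.
  exact: differentiable_rsubmx.
have E : lsubmx y0 = x_ v by rewrite row_mxKl.
have dal' : differentiable (floc A (c_ v) al) (lsubmx y0) by rewrite E.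
have dla := differentiable_comp dl dal'.
rewrite -derive_entry; last exact: differentiable_mulmx.
rewrite (derive_mulmx w dr dla) (derive_chain w dl dal') derive_lsubmx.
rewrite derive_rsubmx /= E derive_floc// floc_at// row_mxKr.
rewrite -{3}[w]hsubmxK mul_row_col addrC; congr (fun_of_matrix (_ + _) 0 0).
by rewrite mulmxA -[RHS]trmx11 [RHS]trmx_mul trmxK.
Qed.

Lemma tangent_map_fst v : tangent_map TA A fst v = col_mx 1%:M 0.
Proof.
rewrite /tangent_map cmap_tangent_at.
set y0 := row_mx _ _.
have dl : differentiable (lsubmx : 'rV[R]_(n + n) -> 'rV[R]_n) y0.
  exact: differentiable_lsubmx.
have E : lsubmx y0 = x_ v by rewrite row_mxKl.
have dc : differentiable (cmap (c_ v) \o cinv (c_ v)) (lsubmx y0).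
  by rewrite E; apply: (differentiable_transition hM) => //; exact: c_at.
rewrite (_ : _ \o _ = (cmap (c_ v) \o cinv (c_ v)) \o lsubmx)//.
rewrite jacobian_comp// E (jacobian_transition_id hM (c_at _) (d_at _)) mulmx1.
apply/row_matrixP => i.
rewrite [LHS]rowE [RHS]rowE -[LHS](deriveEjacobian _ dl) derive_lsubmx.
by rewrite -{2}[delta_mx 0 i]hsubmxK mul_row_col mulmx1 mulmx0 addr0.
Qed.

(** The differential of i_T al fails to be the complete lift of al by the terms
    in the antisymmetrized derivative of al, that is, by i_T d al. *)
Lemma complete_lift_form al v : smooth_form A al ->
  dfun TA (iT1 al) v + iT2 A (dform A al) v =
  col_mx ('D_v.2 (floc A (c_ v) al) (x_ v)) (al v.1).
Proof.
move=> sal; rewrite dfun_iT1// /iT2 tangent_map_fst tr_col_mx trmx1 trmx0.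
rewrite mul_mx_row mulmx1 mulmx0 tr_row_mx trmx0 add_col_mx addr0 derive_floc//.
rewrite /dform; set J := jacobian _ _; congr col_mx.
by rewrite mulmxBr raddfB/= !trmx_mul trmxK addrC subrK.
Qed.

(** When the first derivatives of al and be vanish at m, each of the three terms
    of the bracket reduces to the derivative of pi paired with al and be, with
    signs +, + and - by the antisymmetry of pi. *)
Lemma form_bracket_stationary pi al be m u : is_poisson A pi ->
  smooth_form A al -> smooth_form A be ->
  (forall w, 'D_w (floc A (chart_at A m) al) (cmap (chart_at A m) m) = 0) ->
  (forall w, 'D_w (floc A (chart_at A m) be) (cmap (chart_at A m) m) = 0) ->
  (u *m form_bracket A pi al be m) 0 0 =
  ((al m)^T *m 'D_u (bloc A (chart_at A m) pi) (cmap (chart_at A m) m)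
     *m be m) 0 0.
Proof.
move=> hpi sal sbe; set c := chart_at A m; set x0 := cmap c m => Dal Dbe.
have spi := poisson_smooth hpi.
have dpi : differentiable (bloc A c pi) x0 := differentiable_bloc m spi.
have dal : differentiable (floc A c al) x0 := differentiable_floc m sal.
have dbe : differentiable (floc A c be) x0 := differentiable_floc m sbe.
have Ac : charts A c := c_at m; have cm : cdom c m := d_at m.
have nearc := near_cimg hM Ac cm.
have D_sharp ga (b : 'cV_n) : differentiable (floc A c ga) x0 ->
    (forall w, 'D_w (floc A c ga) x0 = 0) ->
    u *m (jacobian (vloc A c (sharp pi ga)) x0 *m b) =
    (ga m)^T *m 'D_u (bloc A c pi) x0 *m b.
  move=> dga Dga; have dgaT := differentiable_trmx dga.
  have e : \near x0, (floc A c ga x0)^T *m bloc A c pi x0 =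
      vloc A c (sharp pi ga) x0.
    by apply: filterS nearc => x cx; rewrite vloc_sharp.
  have dv := near_eq_differentiable e (differentiable_mulmx dgaT dpi).
  rewrite [LHS]mulmxA -(deriveEjacobian u dv) -(near_eq_derive _ e).
  rewrite (derive_mulmx u dgaT dpi) (derive_trmx u dga) Dga trmx0 mul0mx add0r.
  by rewrite floc_at.
have Dskew : ('D_u (bloc A c pi) x0)^T = - 'D_u (bloc A c pi) x0.
  rewrite -derive_trmx// -deriveN; last exact: diff_derivable.
  congr ('D_u _ x0); apply/funext => x.
  have := poisson_skew hpi (cinv c x); rewrite fctE /bloc /=.
  move: (to_chart A c (cinv c x)) (pi (cinv c x)) => J P skewP.
  by rewrite !trmx_mul trmxK skewP mulNmx mulmxN mulmxA.
have Dpair : (u *m dfun A (bpair pi al be) m) 0 0 =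
    ((al m)^T *m 'D_u (bloc A c pi) x0 *m be m) 0 0.
  have dalT := differentiable_trmx dal.
  have d1 := differentiable_mulmx dalT dpi.
  have d2 := differentiable_mulmx d1 dbe.
  have e : \near x0,
      ((floc A c al x0)^T *m bloc A c pi x0 *m floc A c be x0) 0 0 =
      (bpair pi al be \o cinv c) x0.
    by apply: filterS nearc => x cx; rewrite /= (bpair_loc hM).
  have db := near_eq_differentiable e (differentiable_entry 0 0 d2).
  rewrite -(dfunE db) -(near_eq_derive _ e) -derive_entry//.
  rewrite (derive_mulmx u d1 dbe) (derive_mulmx u dalT dpi).
  rewrite derive_trmx// Dal Dbe.
  by rewrite trmx0 mul0mx add0r mulmx0 addr0 !floc_at.
have mxB (X Y : 'M[R]_1) : (X - Y) 0 0 = X 0 0 - Y 0 0 by rewrite !mxE.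
rewrite /form_bracket /lie_form -/c -/x0 Dal Dbe !add0r !mulmxBr.
rewrite (D_sharp al _ dal Dal) (D_sharp be _ dbe Dbe) !mxB Dpair.
by rewrite (skew_form (be m) (al m) Dskew) opprK addrK.
Qed.

End TangentBundle.

Section TangentLiftCoordinates.
Context {R : realType} {n : nat} {M : Type}.
Variables (A : atlas R n M) (pi : M -> 'M[R]_n).
Variable piT : M * 'rV[R]_n -> 'M[R]_(n + n).
Hypotheses (hM : is_manifold A) (hpi : is_poisson A pi).
Hypothesis hT : is_tangent_lift A pi piT.

Local Notation TA := (tangent_atlas A).
Local Notation c_ v := (chart_at A v.1).
Local Notation x_ v := (cmap (c_ v) v.1).

(** The defining brackets of pi_TM determine it, because the differentials of
    the functions f o tau and i_T al span the covectors at v. With forms al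
    whose derivative vanishes at the base point of v these differentials are
    (df, 0) and (0, al), and the brackets give the blocks 0, pi, pi and the
    derivative of pi along v. *)
Lemma tangent_lift_coords v (p a : 'cV[R]_n) :
  (col_mx p a)^T *m piT v =
  row_mx (a^T *m pi v.1)
    (p^T *m pi v.1 + a^T *m 'D_v.2 (bloc A (c_ v) pi) (x_ v)).
Proof.
have dstat al : smooth_form A al ->
    (forall w, 'D_w (floc A (c_ v) al) (x_ v) = 0) ->
    dfun TA (iT1 al) v = col_mx 0 (al v.1).
  move=> sal Dal; rewrite (dfun_iT1 hM)//; congr col_mx.
  apply/row_matrixP => i; rewrite !rowE mulmxA -[X in X *m _]trmxK.
  by rewrite -derive_floc// Dal trmx0 mul0mx mulmx0.
have ff (a1 b1 : 'cV[R]_n) : ((col_mx a1 0)^T *m piT v *m col_mx b1 0) 0 0 = 0.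
  have [f [sf <-]] := exists_fun_with_differential hM v.1 a1.
  have [g [sg <-]] := exists_fun_with_differential hM v.1 b1.
  rewrite -(dfun_pullback hM v sf) -(dfun_pullback hM v sg).
  exact: (tangent_lift_funs hT sf sg v).
have wf (a1 b1 : 'cV[R]_n) : ((col_mx 0 a1)^T *m piT v *m col_mx b1 0) 0 0 =
    (a1^T *m pi v.1 *m b1) 0 0.
  have [f [sf <-]] := exists_fun_with_differential hM v.1 b1.
  have [al [sal <- Dal]] := exists_stationary_form hM v.1 a1.
  rewrite -(dfun_pullback hM v sf) -dstat//.
  exact: (tangent_lift_form_fun hT sal sf v).
have ww (a1 b1 : 'cV[R]_n) : ((col_mx 0 a1)^T *m piT v *m col_mx 0 b1) 0 0 =
    (a1^T *m 'D_v.2 (bloc A (c_ v) pi) (x_ v) *m b1) 0 0.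
  have [al [sal <- Dal]] := exists_stationary_form hM v.1 a1.
  have [be [sbe <- Dbe]] := exists_stationary_form hM v.1 b1.
  rewrite -dstat// -dstat//.
  have := tangent_lift_forms hT sal sbe v; rewrite /pbracket /bpair => ->.
  by rewrite /iT1 (form_bracket_stationary hM).
have fw (a1 b1 : 'cV[R]_n) : ((col_mx a1 0)^T *m piT v *m col_mx 0 b1) 0 0 =
    (a1^T *m pi v.1 *m b1) 0 0.
  rewrite skew_form; last exact: (poisson_skew (tangent_lift_poisson hT)).
  by rewrite wf -skew_form// (poisson_skew hpi).
suff h (q : 'cV_(n + n)) : ((col_mx p a)^T *m piT v *m q) 0 0 =
  (row_mx (a^T *m pi v.1)
    (p^T *m pi v.1 + a^T *m 'D_v.2 (bloc A (c_ v) pi) (x_ v)) *m q) 0 0.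
  by apply/rowP => j; have := h (delta_mx j 0); rewrite -!colE !mxE.
have -> : col_mx p a = col_mx p 0 + col_mx 0 a.
  by rewrite add_col_mx addr0 add0r.
have -> : q = col_mx (usubmx q) 0 + col_mx 0 (dsubmx q).
  by rewrite add_col_mx addr0 add0r vsubmxK.
set q1 := usubmx q; set q2 := dsubmx q.
rewrite [(_ + _)^T]raddfD/= mulmxDl mulmxDl.
rewrite !mulmxDr !mul_row_col !mulmx0 addr0 add0r.
have mxD (X Y : 'M[R]_1) : (X + Y) 0 0 = X 0 0 + Y 0 0 by rewrite mxE.
by rewrite !mxD ff wf ww fw mulmxDl mxD add0r addrCA.
Qed.

(** The right-hand side is the complete lift of the vector field pi#(al). Its
    second block is the Leibniz rule for the product al^T pi. *)
Lemma sharp_complete_lift al v : smooth_form A al ->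
  hamvf TA piT (iT1 al) v + sharp piT (iT2 A (dform A al)) v =
  row_mx (sharp pi al v.1) ('D_v.2 (vloc A (c_ v) (sharp pi al)) (x_ v)).
Proof.
move=> sal; have dal := differentiable_floc hM v.1 sal.
have dpi := differentiable_bloc hM v.1 (poisson_smooth hpi).
have dalT := differentiable_trmx dal.
rewrite /hamvf /sharp -mulmxDl -raddfD/= complete_lift_form//.
rewrite tangent_lift_coords.
congr row_mx; rewrite -[RHS](@near_eq_derive _ _ _
    (fun x => (floc A (c_ v) al x)^T *m bloc A (c_ v) pi x)); last first.
  have := near_cimg hM (chart_at_atlas hM v.1) (chart_at_dom hM v.1).
  apply: filterS => x cx; rewrite -vloc_sharp//; exact: chart_at_atlas.
by rewrite derive_mulmx// derive_trmx// floc_at// bloc_at.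
Qed.

End TangentLiftCoordinates.

(** * The generator of the lifted action *)

Lemma derive_commute_mx {R : realType} {V : normedModType R} {m n : nat}
    (U : set V) (f : V -> 'M[R]_(m, n)) (x u v : V) :
  open U -> Ck 2 U f -> U x -> 'D_u ('D_v f) x = 'D_v ('D_u f) x.
Proof.
move=> oU f2 Ux; apply/matrixP => i j; have [df dk] := f2.
have DD a b : 'D_a ('D_b f) x i j = 'D_a ('D_b (fun y => f y i j)) x.
  rewrite derive_entry; last exact: (dk b).1.
  apply: near_eq_derive.
  apply: filterS (open_nbhs_nbhs (conj oU Ux)) => y Uy.
  exact: derive_entry (df y Uy).
rewrite [LHS]DD [RHS]DD; apply: (derive_commute _ _ oU _ Ux).
exact: ((Ck_mx 2 _ oU).1 f2 i j).
Qed.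

Section TangentAction.
Context {R : realType} {d n : nat} {G : groupType} {M : Type}.
Variables (AG : atlas R d G) (A : atlas R n M).
Variables (E : 'rV[R]_d -> G) (Phi : G -> M -> M).
Hypotheses (hG : is_manifold AG) (hE : is_exp AG E).
Hypotheses (hM : is_manifold A) (hPhi : is_action AG A Phi).
Implicit Types (c : chart R n M) (p m : M) (xi : 'rV[R]_d).

Local Notation c1 := (chart_at AG 1%g).
Local Notation gam xi := (fun t : R => cmap c1 (E (t *: xi))).

Let c_at := chart_at_atlas hM.
Let d_at := chart_at_dom hM.
Let c1_at : charts AG c1 := chart_at_atlas hG 1%g.

(** The action read in charts, near the unit of G. The flow of xi is this smooth
    function of R^(d + n) along the curve t |-> (exp(t xi), x), which makes the
    mixed derivative in t and x a second derivative of one function. *)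
Definition local_action c c' : 'rV[R]_(d + n) -> 'rV[R]_n :=
  cmap c' \o (fun q : G * M => Phi q.1 q.2) \o cinv (prod_chart c1 c).

Definition local_action_dom c c' : set 'rV[R]_(d + n) :=
  cmap (prod_chart c1 c) @` (cdom (prod_chart c1 c) `&`
    (fun q : G * M => Phi q.1 q.2) @^-1` cdom c').

Lemma local_action_smooth c c' : charts A c -> charts A c' ->
  open (local_action_dom c c') /\
  smooth_on (local_action_dom c c') (local_action c c').
Proof.
move=> Ac Ac'; apply: (action_smooth hPhi) => //.
by exists c1; [exact: c1_at|exists c].
Qed.

Lemma local_action_dom_pt c c' g p : cdom c1 g -> cdom c p ->
  cdom c' (Phi g p) -> local_action_dom c c' (row_mx (cmap c1 g) (cmap c p)).
Proof. by move=> *; exists (g, p). Qed.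

Lemma local_action_domP c c' g x : charts A c -> cdom c1 g ->
  local_action_dom c c' (row_mx (cmap c1 g) x) ->
  exists p, [/\ cdom c p, cdom c' (Phi g p) & x = cmap c p].
Proof.
move=> Ac gd [[g' p] [[/= g'd cp] c'gp] /eq_row_mx[gE <-]].
have E' : g' = g by rewrite -(cmapKE hG c1_at g'd) gE (cmapKE hG c1_at gd).
by exists p; split=> //; rewrite -E'.
Qed.

Lemma local_actionE c c' g x : cdom c1 g ->
  local_action c c' (row_mx (cmap c1 g) x) = cmap c' (Phi g (cinv c x)).
Proof.
move=> gd; rewrite /local_action /= row_mxKl row_mxKr.
by rewrite (cmapKE hG c1_at gd).
Qed.

Lemma exp0 xi : E (0 *: xi) = 1%g.
Proof.
have [_ /(_ 0 0) + _] := hE xi; rewrite addr0 => e.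
by apply: (@mulgI _ (E (0 *: xi))); rewrite mulg1.
Qed.

Lemma exp_near xi : \forall t \near (0 : R), cdom c1 (E (t *: xi)).
Proof.
have [/(_ _ c1_at)[oE _] _ _] := hE xi.
by apply: open_nbhs_nbhs; split=> //=; rewrite exp0; exact: chart_at_dom.
Qed.

Lemma exp_differentiable xi : differentiable (gam xi) (0 : R).
Proof.
have [/(_ _ c1_at)[_ sE] _ _] := hE xi.
by apply: smooth_differentiable sE _; rewrite /= exp0; exact: chart_at_dom.
Qed.

Lemma exp_path_differentiable xi (x : 'rV[R]_n) :
  differentiable (fun t : R => row_mx (gam xi t) x) (0 : R).
Proof.
apply: differentiable_row_mx; first exact: exp_differentiable.
exact: differentiable_cst.
Qed.

Lemma derive_exp_path xi (x : 'rV[R]_n) :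
  'D_1 (fun t : R => row_mx (gam xi t) x) 0 = row_mx xi 0.
Proof.
rewrite derive_row_mx; [|exact: exp_differentiable|exact: differentiable_cst].
by have [_ _ ->] := hE xi; rewrite derive_cst.
Qed.

Lemma local_action_dom0 c c' xi p : cdom c p -> cdom c' p ->
  local_action_dom c c' (row_mx (gam xi 0) (cmap c p)).
Proof.
move=> cp c'p; apply: local_action_dom_pt => //.
  by rewrite exp0; exact: chart_at_dom.
by rewrite exp0 (action1 hPhi).
Qed.

(** Openness of the domain of the local action keeps the flow in the chart for
    small t. *)
Lemma flow_near c xi p : charts A c -> cdom c p ->
  \forall t \near (0 : R), cdom c (Phi (E (t *: xi)) p).
Proof.
move=> Ac cp; have [oU _] := local_action_smooth Ac Ac.
have U0 := local_action_dom0 xi cp cp.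
have ct := differentiable_continuous (exp_path_differentiable xi (cmap c p)).
have := ct _ (open_nbhs_nbhs (conj oU U0)); move: (exp_near xi).
apply: filterS2 => t td /(local_action_domP Ac td)[q [cq + pE]].
by rewrite -(cmapKE hM Ac cp) pE (cmapKE hM Ac cq).
Qed.

Lemma flow_local c c' xi p : charts A c -> cdom c p ->
  \forall t \near (0 : R), local_action c c' (row_mx (gam xi t) (cmap c p)) =
    cmap c' (Phi (E (t *: xi)) p).
Proof.
move=> Ac cp; apply: filterS (exp_near xi) => t td.
by rewrite local_actionE// (cmapKE hM Ac cp).
Qed.

Lemma local_action_differentiable c c' xi p :
  charts A c -> charts A c' -> cdom c p -> cdom c' p ->
  differentiable (local_action c c') (row_mx (gam xi 0) (cmap c p)).
Proof.
move=> Ac Ac' cp c'p; have [_ sU] := local_action_smooth Ac Ac'.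
by apply: smooth_differentiable sU _; exact: local_action_dom0.
Qed.

Lemma flow_differentiable c xi p : charts A c -> cdom c p ->
  differentiable (fun t : R => cmap c (Phi (E (t *: xi)) p)) (0 : R).
Proof.
move=> Ac cp; apply: near_eq_differentiable (flow_local c xi Ac cp) _.
have dg := exp_path_differentiable xi (cmap c p).
exact: (differentiable_comp dg (local_action_differentiable xi Ac Ac cp cp)).
Qed.

Lemma derive_flow c xi p : charts A c -> cdom c p ->
  'D_1 (fun t : R => cmap c (Phi (E (t *: xi)) p)) 0 =
  'D_(row_mx xi 0) (local_action c c) (row_mx (gam xi 0) (cmap c p)).
Proof.
move=> Ac cp; rewrite -(near_eq_derive _ (flow_local c xi Ac cp)).
have dg := exp_path_differentiable xi (cmap c p).
have dl := local_action_differentiable xi Ac Ac cp cp.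
by rewrite (derive_chain _ dg dl) derive_exp_path.
Qed.

Lemma vloc_generator c xi x : charts A c -> cimg c x ->
  vloc A c (generator A E Phi xi) x =
  'D_(row_mx xi 0) (local_action c c) (row_mx (gam xi 0) x).
Proof.
move=> Ac cx; have [cp xE] := cinvK hM Ac cx.
rewrite /vloc -[in RHS]xE -(derive_flow xi Ac cp).
set p := cinv c x; rewrite -/p in cp xE.
have Ap := c_at p; have dp := d_at p.
have df := flow_differentiable xi Ap dp.
have f0 : cmap (chart_at A p) (Phi (E (0 *: xi)) p) = cmap (chart_at A p) p.
  by rewrite exp0 (action1 hPhi).
have dt : differentiable (cmap c \o cinv (chart_at A p))
    (cmap (chart_at A p) (Phi (E (0 *: xi)) p)).
  by rewrite f0; exact: (differentiable_transition hM Ap Ac dp cp).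
have e : \forall t \near (0 : R), ((cmap c \o cinv (chart_at A p)) \o
    (fun t : R => cmap (chart_at A p) (Phi (E (t *: xi)) p))) t =
    cmap c (Phi (E (t *: xi)) p).
  by apply: filterS (flow_near xi Ap dp) => t td /=; rewrite (cmapKE hM Ap td).
rewrite -(near_eq_derive _ e) (derive_chain _ df dt).
by rewrite (deriveEjacobian _ dt) f0.
Qed.

(** The preferred chart at Phi g m, in which the tangent map is expressed,
    cancels when its value is brought back to the chart c. *)
Lemma tangent_map_to_chart c g m : c = chart_at A m -> cdom c1 g ->
  cdom c (Phi g m) ->
  differentiable (fun x => local_action c c (row_mx (cmap c1 g) x))
    (cmap c m) /\
  tangent_map A A (Phi g) m *m to_chart A c (Phi g m) =
  jacobian (fun x => local_action c c (row_mx (cmap c1 g) x)) (cmap c m).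
Proof.
move=> cE gd cgm; have Ac : charts A c by rewrite cE; exact: c_at.
have cm : cdom c m by rewrite cE; exact: d_at.
pose c' := chart_at A (Phi g m); have Ac' : charts A c' := c_at _.
have c'gm : cdom c' (Phi g m) := d_at _.
have diff_la c2 : charts A c2 -> cdom c2 (Phi g m) ->
    differentiable (fun x => local_action c c2 (row_mx (cmap c1 g) x))
      (cmap c m).
  move=> A2 c2gm; have [oU sU] := local_action_smooth Ac A2.
  have U0 := local_action_dom_pt gd cm c2gm.
  have dr : differentiable (fun x : 'rV[R]_n => row_mx (cmap c1 g) x)
      (cmap c m).
    by apply: differentiable_row_mx; [exact: differentiable_cst|exact: ex_diff].
  exact: (differentiable_comp dr (smooth_differentiable sU U0)).
split; first exact: diff_la.
have df : differentiable (cmap c' \o Phi g \o cinv c) (cmap c m).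
  have := diff_la _ Ac' c'gm; congr (differentiable _ _); apply/funext => x.
  by rewrite local_actionE.
have f0 : (cmap c' \o Phi g \o cinv c) (cmap c m) = cmap c' (Phi g m).
  by rewrite /= (cmapKE hM Ac cm).
have dt : differentiable (cmap c \o cinv c')
    ((cmap c' \o Phi g \o cinv c) (cmap c m)).
  by rewrite f0; exact: (differentiable_transition hM Ac' Ac c'gm cgm).
rewrite /tangent_map /to_chart -cE -/c' -f0 -(jacobian_comp df dt).
apply: near_eq_jacobian; last exact: differentiable_comp.
have [oU _] := local_action_smooth Ac Ac'.
have U0 := local_action_dom_pt gd cm c'gm.
have cr : {for cmap c m, continuous (fun x : 'rV[R]_n => row_mx (cmap c1 g) x)}.
  apply: differentiable_continuous.
  by apply: differentiable_row_mx; [exact: differentiable_cst|exact: ex_diff].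
have nearU : \forall x \near cmap c m,
    local_action_dom c c' (row_mx (cmap c1 g) x).
  exact: (cr _ (open_nbhs_nbhs (conj oU U0))).
apply: filterS nearU => x.
move=> /(local_action_domP Ac gd)[p [cp c'p ->]].
by rewrite local_actionE//= !(cmapKE hM).
Qed.

(** In the chart c the lifted flow is the x-derivative of the flow, so that its
    velocity is a mixed derivative; exchanging the derivatives gives the
    complete lift of the generator. *)
Lemma generator_tangent_action xi (v : M * 'rV[R]_n) :
  generator (tangent_atlas A) E (tangent_action A Phi) xi v =
  row_mx (generator A E Phi xi v.1)
    ('D_v.2 (vloc A (chart_at A v.1) (generator A E Phi xi))
       (cmap (chart_at A v.1) v.1)).
Proof.
case: v => m u /=; set c := chart_at A m; set x0 := cmap c m.
have Ac : charts A c := c_at m; have cm : cdom c m := d_at m.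
have [oU sU] := local_action_smooth Ac Ac.
pose H := local_action c c; pose y0 := row_mx (gam xi 0) x0.
have U0 : local_action_dom c c y0 := local_action_dom0 xi cm cm.
have dDH : differentiable ('D_(row_mx 0 u) H) y0.
  by have [_ /(_ (row_mx 0 u))[+ _]] := sU 2%N; exact.
pose f1 (t : R) := cmap c (Phi (E (t *: xi)) m).
pose f2 (t : R) := 'D_(row_mx 0 u) H (row_mx (gam xi t) x0).
have df1 : differentiable f1 (0 : R) := flow_differentiable xi Ac cm.
have dg := exp_path_differentiable xi x0.
have df2 : differentiable f2 (0 : R) := differentiable_comp dg dDH.
have e : \forall t \near (0 : R), row_mx (f1 t) (f2 t) =
    cmap (chart_at (tangent_atlas A) (m, u))
      (tangent_action A Phi (E (t *: xi)) (m, u)).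
  move: (exp_near xi) (flow_near xi Ac cm); apply: filterS2 => t td cd /=.
  have [dj jE] := tangent_map_to_chart erefl td cd.
  rewrite -/c -mulmxA jE -(deriveEjacobian u dj); congr row_mx.
  by rewrite /f2 derive_row_mxr.
rewrite /generator -(near_eq_derive _ e) (derive_row_mx _ df1 df2).
congr row_mx.
rewrite /f2 (derive_chain _ dg dDH) derive_exp_path -/y0.
rewrite (derive_commute_mx _ _ oU (sU 2%N) U0) derive_row_mxr.
apply: near_eq_derive; apply: filterS (near_cimg hM Ac cm) => x cx.
by rewrite vloc_generator.
Qed.

End TangentAction.

(** * The momentum map of the lifted action *)

Lemma smooth_linear {R : realType} {V W : normedModType R} (U : set V)
    (f : {linear V -> W}) : continuous f -> smooth_on U f.
Proof.
move=> cf [|k]; first by move=> x _; exact: cf.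
split=> [x _|v]; first exact: linear_differentiable.
have -> : 'D_v f = fun _ => f v by apply/funext => x; exact: derive_linear.
exact: Ck_cst.
Qed.

Lemma open_tangent_cimg {R : realType} {n : nat} {M : Type} (A : atlas R n M)
    c :
  is_manifold A -> charts A c -> open (cimg (tangent_chart A c)).
Proof.
move=> hM Ac.
rewrite (_ : cimg _ = (lsubmx : 'rV[R]_(n + n) -> 'rV[R]_n) @^-1` cimg c).
  apply: open_comp => [x _|]; last exact: (open_cimg hM).
  exact: continuous_lsubmx.
apply/seteqP; split=> [_ [v cv <-]|y [m cm my]].
  by exists v.1 => //=; rewrite row_mxKl.
exists (m, rsubmx y *m of_chart A c m) => //=.
by rewrite -mulmxA (of_chartK hM)// mulmx1 my hsubmxK.
Qed.

Lemma smooth_fun_iT1 {R : realType} {n : nat} {M : Type} (A : atlas R n M)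
    al :
  is_manifold A -> smooth_form A al -> smooth_fun (tangent_atlas A) (iT1 al).
Proof.
move=> hM sal _ [c Ac <-] k.
have oU := open_tangent_cimg hM Ac; set U := cimg _ in oU *.
have UP y : U y -> cimg c (lsubmx y).
  by move=> [v cv <-]; exists v.1 => //=; rewrite row_mxKl.
have cl : Ck k U (lsubmx : 'rV[R]_(n + n) -> 'rV[R]_n).
  exact: (smooth_linear U (@continuous_lsubmx _ _ _ _) k).
have cr : Ck k U (rsubmx : 'rV[R]_(n + n) -> 'rV[R]_n).
  exact: (smooth_linear U (@continuous_rsubmx _ _ _ _) k).
have ca : Ck k U (fun y => floc A c al (lsubmx y)).
  apply/(Ck_mx _ _ oU) => i j.
  have := (Ck_mx _ _ (open_cimg hM Ac)).1 (sal c Ac k) i j.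
  exact: (Ck_comp oU UP cl).
apply: (Ck_eq oU _ ((Ck_mx _ _ oU).1 (Ck_mulmx oU cr ca) 0 0)) => y _.
by rewrite /iT1 /floc /= mulmxA.
Qed.

Theorem theorem1p2 (R : realType) (d n : nat) (G : groupType) (M : Type)
  (AG : atlas R d G) (A : atlas R n M)
  (piG : G -> 'M[R]_d) (pi : M -> 'M[R]_n)
  (piT : M * 'rV[R]_n -> 'M[R]_(n + n))
  (E : 'rV[R]_d -> G) (Phi : G -> M -> M)
  (phi : 'rV[R]_d -> M -> 'cV[R]_n)
  (hG : is_poisson_lie_group AG piG)
  (hE : is_exp AG E)
  (hM : is_manifold A)
  (hpi : is_poisson A pi)
  (hpiT : is_tangent_lift A pi piT)
  (hPhi : is_action AG A Phi)
  (hphi : is_inf_momentum_map AG A E piG pi Phi phi) :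
  (forall xi v,
     generator (tangent_atlas A) E (tangent_action A Phi) xi v
     = hamvf (tangent_atlas A) piT (iT1 (phi xi)) v
       + sharp piT (iT2 A (dform A (phi xi))) v)
  /\
  ((forall xi m, dform A (phi xi) m = 0) ->
   exists c : M * 'rV[R]_n -> 'cV[R]_d,
     [/\ forall xi v, component c xi v = iT1 (phi xi) v,
         forall m, linear (fun u : 'rV[R]_n => c (m, u)) &
         is_hamiltonian AG (tangent_atlas A) piT
           (generator (tangent_atlas A) E (tangent_action A Phi)) c]).
Proof.
have hAG : is_manifold AG := lie_group_manifold (plg_lie_group hG).
have sphi xi : smooth_form A (phi xi) := imm_smooth hphi xi.
have lift xi v : generator (tangent_atlas A) E (tangent_action A Phi) xi v =
    hamvf (tangent_atlas A) piT (iT1 (phi xi)) v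
    + sharp piT (iT2 A (dform A (phi xi))) v.
  rewrite (sharp_complete_lift hM hpi hpiT v (sphi xi)).
  rewrite (generator_tangent_action hAG hE hM hPhi xi v).
  have -> : generator A E Phi xi = sharp pi (phi xi).
    by apply/funext => m; exact: imm_generator hphi xi m.
  by [].
split=> // closed.
(* The momentum map is linear in xi, so that the forms of a basis of the Lie
   algebra provide the coordinates of c. *)
have phi_sum xi m : phi xi m = \sum_i xi 0 i *: phi (delta_mx 0 i) m.
  pose L := GRing.isLinear.Build _ _ _ _ _ (imm_linear hphi m).
  pose f : {linear 'rV[R]_d -> 'cV[R]_n} := HB.pack (fun xi => phi xi m) L.
  rewrite -[LHS]/(f xi) {1}(row_sum_delta xi) linear_sum.
  by apply: eq_bigr => i _; rewrite linearZ.
pose c v : 'cV[R]_d := \col_i iT1 (phi (delta_mx 0 i)) v.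
have cE xi : component c xi = iT1 (phi xi).
  apply/funext => v; rewrite /component /iT1 phi_sum mulmx_sumr summxE mxE.
  by apply: eq_bigr => i _; rewrite mxE -scalemxAr [RHS]mxE.
exists c; split=> [xi v|m a u w|]; first by rewrite cE.
  by apply/colP => i; rewrite !mxE /iT1 /= mulmxDl -scalemxAl !mxE.
split=> [tc Atc k|xi v|xi eta v].
- have oU : open (cimg tc) by case: Atc => cc Acc <-; exact: open_tangent_cimg.
  apply/(Ck_mx _ _ oU) => i j.
  have := smooth_fun_iT1 hM (sphi (delta_mx 0 i)) Atc k.
  by apply: Ck_eq => // y _; rewrite [RHS]mxE.
- rewrite lift cE (_ : sharp _ _ _ = 0) ?addr0//.
  by rewrite /sharp /iT2 closed mulmx0 mul0mx !trmx0 mul0mx.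
- rewrite !cE (tangent_lift_forms hpiT (sphi xi) (sphi eta)).
  by rewrite /iT1 -(imm_bracket hphi).
Qed.
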